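(* Suppose $\mathcal Q$ is vertically unbounded and $s_\infty=1$. Then $B=B^{ct}\sqcup B^{unb}$.
   Context: Let $(K,v)$ be a valued field, $\Gamma$ the divisible hull of $vK$, embedded in a divisible ordered abelian group $\Lambda$. Let $\nu\colon K[x]\to\Lambda\cup\{\infty\}$ be a valuation extending $v$ which is well-specified, i.e. it is not the case that simultaneously $\nu^{-1}(\infty)=0$, the value group of $\nu$ modulo $\Gamma$ is torsion, and the residue field of $\nu$ is algebraic over that of $v$. For $s\ge0$ let $\partial_s$ be the $s$-th Hasse–Schmidt derivative, defined by $f(x+y)=\sum_{s\ge0}(\partial_sf)y^s$. For nonconstant $f$ with $\nu(f)<\infty$ the level is $\epsilon_\nu(f)=\max\{(\nu(f)-\nu(\partial_sf))/s: s\ge1\}$ and $I(f)$ is the set of $s\ge1$ attaining the maximum; $\epsilon_\nu(a)=-\infty$ for $a\in K$. A monic $Q\in K[x]$ is a key polynomial for $\nu$ if $\epsilon_\nu(f)<\epsilon_\nu(Q)$ whenever $\deg f<\deg Q$. For monic $Q$, each $f$ has a unique $Q$-expansion $f=\sum_{i\ge0}f_{Q,i}Q^i$ with $\deg f_{Q,i}<\deg Q$; set $\nu_Q(f)=\min_i\nu(f_{Q,i}Q^i)$. Fix $m\ge1$ such that the set $\Psi_m$ of key polynomials of degree $m$ for $\nu$ is nonempty and has no element of maximal $\nu$-value. Let $\mathcal Q\subseteq\Psi_m$ be well-ordered by $Q<R\iff\nu(Q)<\nu(R)$ and cofinal in $\Psi_m$ for $\nu$-values; write $\gamma_Q=\nu(Q)$.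 As in the paper, all values $\nu_Q(f)$ ($f\ne0$) lie in $\Gamma$. ''For all $Q$ large enough'' means for all $Q$ in a final segment of $\mathcal Q$; a family indexed by $\mathcal Q$ is ultimately constant if it is constant on a final segment. For all $Q$ large enough, $I(Q)=\{s_\infty\}$ for a fixed integer $s_\infty\ge1$. $f$ is $\mathcal Q$-stable if $\nu_Q(f)=\nu(f)$ for all $Q$ large enough, $\mathcal Q$-unstable otherwise. Assume unstable polynomials exist; limit key polynomials are the monic $\mathcal Q$-unstable polynomials of minimal degree, forming $\mathrm{KP}_\infty(\mathcal Q)$. Fix $F\in\mathrm{KP}_\infty(\mathcal Q)$, $D=\lfloor\deg F/m\rfloor$, $F=\sum_{\ell=0}^DF_{Q,\ell}Q^\ell$, $\beta_{Q,\ell}=\nu(F_{Q,\ell})\in\Gamma\cup\{\infty\}$. Let $\delta^L$ be the smallest initial segment of $\Gamma$ containing $\{\nu_Q(F):Q\in\mathcal Q\}$; write $x>\delta^L$ if $x\in(\Gamma\setminus\delta^L)\cup\{\infty\}$. Let $J$ be the set of $\ell\in\{0,\dots,D\}$ with $\beta_{Q,\ell}+\ell\gamma_Q>\delta^L$ for all $Q$ large enough, $B=\{0,\dots,D\}\setminus J$, and $B^{ct}$ the set of $\ell\in B$ for which $(\beta_{Q,\ell})_Q$ is ultimately constant. A cut $\eta=(\eta^L,\eta^R)$ of $\Gamma$ is vertically bounded if for every $x\in\eta^L$ and rational $q>1$ there is $y\in\eta^L$ with $q(y-x)>z-x$ for all $z\in\eta^L$. Let $\gamma_{\mathcal Q}$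 be the cut whose lower set is the smallest initial segment of $\Gamma$ containing $\{\gamma_Q\}$; $\mathcal Q$ is vertically unbounded if $\gamma_{\mathcal Q}$ is not vertically bounded. For $\ell\in\{0,\dots,D\}$, $\mathcal B_\ell$ is the smallest initial segment of $\Gamma$ containing all $\beta\in\Gamma$ such that $\beta+\ell\gamma_Q\in\delta^L$ for some $Q\in\mathcal Q$. $B^{unb}$ is the set of $\ell\in B$ such that for every $\beta\in\mathcal B_\ell$ one has $\beta_{Q,\ell}\ge\beta$ for all $Q$ large enough. *)

(* Defs.v *)
From mathcomp Require Import all_boot all_order all_algebra.
Set Implicit Arguments. Unset Strict Implicit. Unset Printing Implicit Defensive.
Import Order.TTheory GRing.Theory Num.Theory.
Local Open Scope ring_scope.

(* Conventions:
   - Lambda, a divisible ordered abelian group, is given as a Q-vector space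
     [L : lmodType rat] together with a total order [le] compatible with +.
   - Lambda u {oo} is [option L]; [None] is oo.
   - v : K -> option L is the valuation of K, nu : {poly K} -> option L the
     valuation on K[x]. *)

Section ValuedPolys.
Context {K : fieldType} {L : lmodType rat}.
Variable le : rel L.

Definition ordered_group : Prop :=
  [/\ (forall x, le x x),
      (forall x y, le x y -> le y x -> x = y),
      (forall x y z, le x y -> le y z -> le x z),
      (forall x y, le x y || le y x) &
      (forall x y z, le x y -> le (x + z) (y + z))].

Definition vle (x y : option L) : bool :=
  match x, y with
  | _, None => true
  | None, Some _ => false
  | Some a, Some b => le a b
  end.
Definition vlt (x y : option L) : bool := ~~ vle y x.
Definition vadd (x y : option L) : option L :=
  match x, y with Some a, Some b => Some (a + b) | _, _ => None end.
Definition vmin (x y : option L) : option L := if vle x y then x else y.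

Variable v : K -> option L.

Definition is_valuation_K : Prop :=
  [/\ (forall a, v a = None <-> a = 0),
      (forall a b, v (a * b) = vadd (v a) (v b)) &
      (forall a b, vle (vmin (v a) (v b)) (v (a + b)))].

Definition inGamma (g : L) : Prop :=
  exists n : nat, (0 < n)%N /\ exists a : K, a != 0 /\ v a = Some (g *+ n).

Variable nu : {poly K} -> option L.

(* nu is a valuation on K[x] (possibly with nonzero support) extending v *)
Definition is_valuation_ext : Prop :=
  [/\ nu 0 = None, nu 1 = Some 0,
      (forall f g, nu (f * g) = vadd (nu f) (nu g)),
      (forall f g, vle (vmin (nu f) (nu g)) (nu (f + g))) &
      (forall a : K, nu a%:P = v a)].

Definition trivial_support : Prop := forall f, nu f = None -> f = 0.

Definition value_group_torsion_mod_Gamma : Prop :=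
  forall f g a b, nu f = Some a -> nu g = Some b ->
    exists n : nat, (0 < n)%N /\ inGamma ((a - b) *+ n).

(* the residue field of nu is algebraic over the residue field of v:
   every residue class of f/g (with nu f = nu g < oo) is a root of a nonzero
   polynomial over k_v, i.e. there are c_0..c_n in O_v, not all in m_v, with
   nu (sum c_i f^i g^(n-i)) > n nu(g). *)
Definition residue_algebraic : Prop :=
  forall f g a, nu f = Some a -> nu g = Some a ->
    exists (n : nat) (c : 'I_n.+1 -> K),
      [/\ (forall i, vle (Some 0) (v (c i))),
          (exists i, v (c i) = Some 0) &
          vlt (Some (a *+ n))
              (nu (\sum_(i < n.+1) (c i)%:P * f ^+ i * g ^+ (n - i)))].

Definition well_specified : Prop :=
  ~ [/\ trivial_support, value_group_torsion_mod_Gamma & residue_algebraic].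

Inductive ext := MInf | Fin of L | PInf.

Definition ext_le (x y : ext) : bool :=
  match x, y with
  | MInf, _ => true
  | _, PInf => true
  | Fin a, Fin b => le a b
  | _, _ => false
  end.
Definition ext_lt (x y : ext) : bool := ~~ ext_le y x.
Definition ext_max (x y : ext) : ext := if ext_le x y then y else x.

Definition slope (f : {poly K}) (s : nat) : ext :=
  match nu f, nu (f^`N(s)) with
  | Some a, Some b => Fin ((s%:R : rat)^-1 *: (a - b))
  | Some _, None => MInf
  | None, Some _ => PInf
  | None, None => MInf
  end.

(* epsilon_nu(f): -oo for constants; max over 1 <= s <= deg f otherwise
   (for s > deg f the slope is -oo). When nu f = oo (f nonconstant) this
   gives +oo. *)
Definition level (f : {poly K}) : ext :=
  if (size f <= 1)%N then MInf
  else \big[ext_max/MInf]_(1 <= s < size f) slope f s.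

Definition Iset (f : {poly K}) (s : nat) : Prop :=
  (0 < s)%N /\ slope f s = level f.

Definition key_poly (Q : {poly K}) : Prop :=
  Q \is monic /\
  forall f : {poly K}, (size f < size Q)%N -> ext_lt (level f) (level Q).

Definition Psi (m : nat) (Q : {poly K}) : Prop := key_poly Q /\ size Q = m.+1.

Definition qcoef (Q f : {poly K}) (i : nat) : {poly K} := (f %/ Q ^+ i) %% Q.

Definition nuQ (Q f : {poly K}) : option L :=
  \big[vmin/None]_(i < size f) nu (qcoef Q f i * Q ^+ i).

Variable Qs : {poly K} -> Prop.

Definition eventually (P : {poly K} -> Prop) : Prop :=
  exists Q0, Qs Q0 /\ forall Q, Qs Q -> vle (nu Q0) (nu Q) -> P Q.

Definition ult_const {T : Type} (h : {poly K} -> T) : Prop :=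
  exists c : T, eventually (fun Q => h Q = c).

Definition stable (f : {poly K}) : Prop := eventually (fun Q => nuQ Q f = nu f).

Definition KP_inf (F : {poly K}) : Prop :=
  [/\ F \is monic, ~ stable F &
      forall G : {poly K}, G \is monic -> ~ stable G -> (size F <= size G)%N].

Variable F : {poly K}.

Definition deltaL (g : L) : Prop :=
  inGamma g /\ exists Q, Qs Q /\ vle (Some g) (nuQ Q F).

Definition above_delta (x : option L) : Prop :=
  match x with None => True | Some g => inGamma g /\ ~ deltaL g end.

Variable m : nat.

Definition Dmax : nat := ((size F).-1 %/ m)%N.

Definition beta (Q : {poly K}) (l : nat) : option L := nu (qcoef Q F l).

Definition Jset (l : nat) : Prop :=
  (l <= Dmax)%N /\
  eventually (fun Q => above_delta (vadd (beta Q l) (nu (Q ^+ l)))).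

Definition Bset (l : nat) : Prop := (l <= Dmax)%N /\ ~ Jset l.

Definition Bct (l : nat) : Prop := Bset l /\ ult_const (fun Q => beta Q l).

Definition calB (l : nat) (b : L) : Prop :=
  inGamma b /\
  exists b', [/\ inGamma b', le b b' &
     exists Q g, [/\ Qs Q, nu Q = Some g & deltaL (b' + g *+ l)]].

Definition Bunb (l : nat) : Prop :=
  Bset l /\ forall b, calB l b -> eventually (fun Q => vle (Some b) (beta Q l)).

End ValuedPolys.

Definition vert_bounded {L : lmodType rat} (le : rel L) (etaL : L -> Prop) : Prop :=
  forall x, etaL x -> forall q : rat, 1 < q ->
    exists y, etaL y /\ forall z, etaL z -> ~~ le (q *: (y - x)) (z - x).

Definition gammaQL {K : fieldType} {L : lmodType rat} (le : rel L)
  (v : K -> option L) (nu : {poly K} -> option L) (Qs : {poly K} -> Prop)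
  (g : L) : Prop :=
  inGamma v g /\ exists Q, Qs Q /\ vle le (Some g) (nu Q).

(* Main.v *)
(* Write W(R, lam, b) for the polynomials h all of whose R-coefficients satisfy
   nu(h_{R,i}) + i lam >= b. Let Q <= R in the family and f, g of degree < m.
   Applying the s-th Hasse derivative, s in I(Q), to the division
   f g = q R + r gives nu(r) >= nu(f g) and nu(q) + gamma_Q >= nu(f g); hence
   the sets W(R, gamma_Q, b) are multiplicative in b, and they do not depend on
   R >= Q. Expanding F = sum_j F_{R,j} (S - (S - R))^j over S >= R >= Q then gives
     nu(F_{S,l} - F_{R,l}) >= nu_Q(F) - l gamma_Q + (gamma_R - gamma_Q).
   A vertically unbounded cut is a coset x + Delta of a convex subgroup, so the
   right-hand side exceeds every bound of the form nu_Q(F) - l gamma_Q1 as R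
   grows, provided gamma_Q - gamma_Q1 lies in Delta: either beta_{R,l} reaches
   that bound or it becomes constant. If instead gamma_Q1 lies below x + Delta,
   the derivative G of F with respect to Q satisfies
   nu(G_{R,0} - F_{R,l}) >= nu_Q(F) - l gamma_Q + (gamma_Q - gamma_Q1); being of
   degree less than deg F it is stable, which forces beta_{R,l} to be constant
   for l in B. *)
Require Import Defs.
From HB Require Import structures.
From mathcomp Require Import all_boot all_order all_algebra.
From mathcomp Require Import ring lra zify.
From Stdlib Require Import Classical.
Set Implicit Arguments. Unset Strict Implicit. Unset Printing Implicit Defensive.
Import Order.TTheory GRing.Theory Num.Theory.
Local Open Scope ring_scope.

(* The square-zero extension Q + L of Q is a commutative ring containing L
   additively, so that [ring] decides the identities of the Q-vector space L. *)
Definition dual_numbers (L : lmodType rat) : Type := (rat * L)%type.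

Section DualNumbers.
Variable L : lmodType rat.
HB.instance Definition _ := GRing.Zmodule.on (dual_numbers L).
Implicit Types x y z : dual_numbers L.
Let one : dual_numbers L := (1, 0).
Let mul x y : dual_numbers L := (x.1 * y.1, x.1 *: y.2 + y.1 *: x.2).

Fact dual_mulA : associative mul.
Proof.
move=> [a x] [b y] [c z]; rewrite /mul /= mulrA !scalerDr !scalerA addrA.
by rewrite (mulrC c a) (mulrC c b).
Qed.

Fact dual_mulC : commutative mul.
Proof. by move=> [a x] [b y]; rewrite /mul /= mulrC addrC. Qed.

Fact dual_mul1 : left_id one mul.
Proof. by move=> [a x]; rewrite /mul /= mul1r scale1r scaler0 addr0. Qed.

Fact dual_mulDl : left_distributive mul (@GRing.add (dual_numbers L)).
Proof.
move=> [a x] [b y] [c z]; rewrite /mul /= mulrDl; congr (_, _).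
by rewrite scalerDl scalerDr addrACA.
Qed.

Fact dual_one_neq0 : one != 0.
Proof. by apply/eqP => -[] /eqP; rewrite oner_eq0. Qed.

HB.instance Definition _ := GRing.Zmodule_isComNzRing.Build (dual_numbers L)
  dual_mulA dual_mulC dual_mul1 dual_mulDl dual_one_neq0.

Definition dual_eps (x : L) : dual_numbers L := (0, x).

Fact dual_eps_is_additive : {morph dual_eps : x y / x - y}.
Proof. by move=> x y; congr (_, _); rewrite subr0. Qed.

HB.instance Definition _ :=
  GRing.isZmodMorphism.Build L (dual_numbers L) dual_eps dual_eps_is_additive.

Lemma dual_eps_inj : injective dual_eps.
Proof. by move=> x y []. Qed.
End DualNumbers.

Ltac zmod := apply: dual_eps_inj; ring.

(** * Linear inequalities in an ordered Q-vector space *)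

Section OrderedGroup.
Context {L : lmodType rat} (le : rel L) (ole : ordered_group le).
Implicit Types a b c d x y z : L.
Notation lt x y := (~~ le y x).

Lemma le_refl x : le x x. Proof. by case: ole. Qed.

Lemma le_tr x y z : le x y -> le y z -> le x z.
Proof. by case: ole => _ _ h _ _; apply: h. Qed.

Lemma le_asym x y : le x y -> le y x -> x = y.
Proof. by case: ole => _ h _ _ _; apply: h. Qed.

Lemma lt_le x y : lt x y -> le x y.
Proof. by case: ole => _ _ _ h _; case/orP: (h x y) => // ->. Qed.

(** Reduces a linear inequality to a known one: once the hypotheses are added up by [leD], only an
    identity between two differences is left, and [zmod] proves it. *)
Lemma le_shift x y a b : le x y -> y - x = b - a -> le a b.
Proof.
case: ole => _ _ _ _ h /(h _ _ (a - x)); rewrite subrKC => + e.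
suff -> : y + (a - x) = b by [].
by rewrite addrCA e subrKC.
Qed.

Lemma lt_shift x y a b : lt x y -> y - x = b - a -> lt a b.
Proof.
move=> h e; apply/negP => h'; case/negP: h; apply: (le_shift h').
by rewrite -[LHS]opprB -e opprB.
Qed.

Lemma leD a b c d : le a b -> le c d -> le (a + c) (b + d).
Proof.
by move=> h1 h2; apply: (@le_tr _ (b + c));
  [apply: (le_shift h1); zmod | apply: (le_shift h2); zmod].
Qed.

Lemma lt_le_tr x y z : lt x y -> le y z -> lt x z.
Proof. by move=> h h'; apply/negP => h2; case/negP: h; apply: le_tr h2. Qed.

Lemma le_lt_tr x y z : le x y -> lt y z -> lt x z.
Proof. by move=> h h'; apply/negP => h2; case/negP: h'; apply: le_tr h. Qed.

Lemma lt_leD a b c d : lt a b -> le c d -> lt (a + c) (b + d).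
Proof.
by move=> h1 h2; apply: (@lt_le_tr _ (b + c));
  [apply: (lt_shift h1); zmod | apply: (le_shift h2); zmod].
Qed.

Lemma leMn x y n : le x y -> le (x *+ n) (y *+ n).
Proof.
move=> h; elim: n => [|n ih]; first by rewrite !mulr0n; apply: le_refl.
by rewrite !mulrS; apply: leD.
Qed.

Lemma ltMn x y n : (0 < n)%N -> lt x y -> lt (x *+ n) (y *+ n).
Proof.
case: n => // n _ h; rewrite !mulrS; apply: (lt_leD h).
by apply: leMn; apply: lt_le.
Qed.

Lemma leMn_inv x y n : (0 < n)%N -> le (x *+ n) (y *+ n) -> le x y.
Proof. by move=> n0 h; apply/negPn/negP => /(ltMn n0); rewrite h. Qed.

Lemma le_mulrn_mono x n k : le 0 x -> (n <= k)%N -> le (x *+ n) (x *+ k).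
Proof.
move=> h /subnKC <-; move: (leMn (k - n) h); rewrite mul0rn => h'.
by apply: (le_shift h'); zmod.
Qed.

Lemma scale_natV n x : (0 < n)%N -> ((n%:R : rat)^-1 *: x) *+ n = x.
Proof.
move=> n0; rewrite -scaler_nat scalerA mulfV ?scale1r //.
by rewrite pnatr_eq0 -lt0n.
Qed.

(** Multiplying by the denominator turns r into a natural number, and a positive integer factor can
    be cancelled from an inequality. *)
Lemma le_scale (r : rat) x : 0 <= r -> le 0 x -> le 0 (r *: x).
Proof.
move=> r0 x0; pose n := `|denq r|%N.
have n0 : (0 < n)%N by rewrite absz_gt0 denq_neq0.
apply: (leMn_inv n0); rewrite mul0rn -scaler_nat scalerA.
have -> : n%:R * r = `|numq r|%N%:R.
  rewrite -[in LHS](divq_num_den r) mulrC !pmulrn /n.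
  have -> : (`|denq r|%N%:Z)%:~R = (denq r)%:~R :> rat by rewrite gez0_abs.
  rewrite mulfVK ?intr_eq0 ?denq_neq0 // gez0_abs //.
  by rewrite numq_ge0.
by rewrite scaler_nat -(mul0rn _ `|numq r|); apply: leMn.
Qed.

Lemma mulrn_eq0_torsion x n : (0 < n)%N -> x *+ n = 0 -> x = 0.
Proof.
by move=> n0 h; apply: le_asym; apply: (leMn_inv n0); rewrite h mul0rn le_refl.
Qed.

End OrderedGroup.

(** * Hasse derivatives and Taylor expansion *)

(** Leibniz rule, by induction on f in Horner form with s general, since order s+1 of f X + c
    involves orders s and s+1 of f. *)
Lemma nderivnM (R : comNzRingType) (s : nat) (f g : {poly R}) :
  (f * g)^`N(s) = \sum_(i < s.+1) f^`N(i) * g^`N(s - i).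
Proof.
elim/poly_ind: f s => [|f c ih] s.
  rewrite mul0r raddf0 big1 // => i _.
  by rewrite raddf0 mul0r.
case: s => [|s]; first by rewrite big_ord1 !nderivn0.
have -> : (f * 'X + c%:P) * g = (f * g * 'X + 0%:P) + c *: g.
  by rewrite -mul_polyC polyC0; ring.
rewrite nderivnD nderivnMXaddC nderivnZ big_ord_recl nderivn0 subn0.
under eq_bigr => i _ do
  rewrite /= /bump leq0n add1n nderivnMXaddC subSS mulrDl -mulrA (mulrC 'X) mulrA.
rewrite big_split /= -ih -mulr_suml.
have -> : (f * g)^`N(s.+1) =
  f * g^`N(s.+1) + \sum_(i < s.+1) f^`N(i.+1) * g^`N(s - i).
  by rewrite ih big_ord_recl nderivn0 subn0.
by rewrite -mul_polyC; ring.
Qed.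

Lemma nderivn_lead (R : nzRingType) (f : {poly R}) :
  f^`N((size f).-1) = (lead_coef f)%:P.
Proof.
apply/polyP => -[|i]; rewrite coef_nderivn coefC /=.
  by rewrite addn0 binn mulr1n lead_coefE.
by rewrite nth_default ?mul0rn //; lia.
Qed.

Lemma size_subC (K : fieldType) (f g : {poly K}) : size (f - g) = size (g - f).
Proof. by rewrite -opprB size_polyN. Qed.

(** In the Taylor expansion of A at x with increment R, every term but the first is a multiple of
    R. *)
Lemma horner_mod (K : fieldType) (A : {poly {poly K}}) (x R : {poly K}) :
  A.[x + R] %% R = A.[x] %% R.
Proof.
rewrite (@nderiv_taylor_wide _ (size A).+1) //; last exact: mulrC.
rewrite big_ord_recl nderivn0 expr0 mulr1 modpD.
under eq_bigr => i _ do rewrite /= /bump leq0n add1n exprSr mulrA.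
by rewrite -mulr_suml modp_mull addr0.
Qed.

(** * Expansions in powers of a monic polynomial of degree m *)

Section QExpansion.
Context {K : fieldType} (m : nat) (R : {poly K}).
Hypotheses (m_gt0 : (0 < m)%N) (Rmon : R \is monic) (sizeR : size R = m.+1).
Implicit Types f g h : {poly K}.

Let R_neq0 : R != 0. Proof. exact: monic_neq0. Qed.

Lemma qcoefD i : {morph qcoef R ^~ i : f g / f + g}.
Proof. by move=> f g; rewrite /qcoef divpD modpD. Qed.

Lemma qcoefZ i c f : qcoef R (c *: f) i = c *: qcoef R f i.
Proof. by rewrite /qcoef divpZl modpZl. Qed.

Lemma qcoef_eq0 i : qcoef R 0 i = 0.
Proof. by rewrite /qcoef div0p mod0p. Qed.

Lemma qcoefN i f : qcoef R (- f) i = - qcoef R f i.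
Proof. by rewrite -scaleN1r qcoefZ scaleN1r. Qed.

Lemma qcoef_sum i (I : Type) (r : seq I) (P : pred I) (H : I -> {poly K}) :
  qcoef R (\sum_(j <- r | P j) H j) i = \sum_(j <- r | P j) qcoef R (H j) i.
Proof. by apply: (big_morph _ (qcoefD i)); rewrite qcoef_eq0. Qed.

Lemma qcoef0E f : qcoef R f 0 = f %% R.
Proof. by rewrite /qcoef expr0 divp1. Qed.

Lemma qcoefS f i : qcoef R f i.+1 = qcoef R (f %/ R) i.
Proof. by rewrite /qcoef exprS divp_divl. Qed.

Lemma size_qcoef f i : (size (qcoef R f i) <= m)%N.
Proof. by rewrite -ltnS -sizeR ltn_modp. Qed.

Lemma qcoef_small f i : (size f <= m)%N -> qcoef R f i = if i is 0 then f else 0.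
Proof.
move=> fm; have fR : (size f < size R)%N by rewrite sizeR ltnS.
by case: i => [|i]; [rewrite qcoef0E modp_small | rewrite qcoefS divp_small // qcoef_eq0].
Qed.

Lemma qcoefM f i : qcoef R (f * R) i = if i is j.+1 then qcoef R f j else 0.
Proof. by case: i => [|i]; rewrite ?qcoef0E ?modp_mull // qcoefS mulpK. Qed.

Lemma qcoef_mulX n f i :
  qcoef R (f * R ^+ n) i = if (n <= i)%N then qcoef R f (i - n) else 0.
Proof.
elim: n i => [|n ih] i; first by rewrite expr0 mulr1 subn0.
by rewrite exprSr mulrA qcoefM; case: i => [|i] //; rewrite ih subSS.
Qed.

Lemma size_quo f : size (f %/ R) = (size f - m)%N.
Proof. by rewrite size_divp // sizeR. Qed.

Lemma size_div_lt f n : (size f <= n.+1)%N -> (size (f %/ R)%R <= n)%N.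
Proof. by rewrite size_quo; move: m_gt0; lia. Qed.

Lemma qcoef_big f i : (size f <= i)%N -> qcoef R f i = 0.
Proof.
elim: i f => [|i ih] f.
  by rewrite leqn0 size_poly_eq0 => /eqP ->; rewrite qcoef_eq0.
by move=> h; rewrite qcoefS ih // size_div_lt.
Qed.

Lemma qcoef_expand n f : (size f <= n)%N -> f = \sum_(i < n) qcoef R f i * R ^+ i.
Proof.
elim: n f => [|n ih] f.
  by rewrite leqn0 size_poly_eq0 big_ord0 => /eqP.
move=> h; rewrite big_ord_recl expr0 mulr1 qcoef0E.
under eq_bigr => i _ do rewrite /= /bump leq0n add1n qcoefS exprSr mulrA.
by rewrite -mulr_suml -ih ?size_div_lt // addrC -divp_eq.
Qed.

(** Uniqueness of the R-expansion, with an expansion encoded as a polynomial in a new variable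
    evaluated at R. *)
Lemma qcoef_horner (A : {poly {poly K}}) i :
  (forall j, (size (A`_j)%R <= m)%N) -> qcoef R A.[R] i = A`_i.
Proof.
elim/poly_ind: A i => [|A c ih] i hA; first by rewrite horner0 qcoef_eq0 coef0.
have hc : (size c <= m)%N.
  by move: (hA 0); rewrite coefD coefMX coefC /= add0r.
have hA' j : (size (A`_j)%R <= m)%N.
  by move: (hA j.+1); rewrite coefD coefMX coefC /= addr0.
rewrite hornerMXaddC qcoefD qcoefM qcoef_small // coefD coefMX coefC.
by case: i => [//|i] /=; rewrite ih.
Qed.

Lemma qcoef_size_lt f i : qcoef R f i != 0 ->
  (size (qcoef R f i) + i * m <= size f)%N.
Proof.
elim: i f => [|i ih] f; first by rewrite qcoef0E mul0n addn0 leq_modp.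
rewrite qcoefS => h; move: (ih _ h); rewrite size_quo.
have : qcoef R (f %/ R) i != 0 by [].
by rewrite -size_poly_gt0; lia.
Qed.

End QExpansion.

(** * Lower bounds for values *)

Section Valuation.
Context {K : fieldType} {L : lmodType rat} (le : rel L).
Context (v : K -> option L) (nu : {poly K} -> option L).
Hypotheses (ole : ordered_group le) (val : is_valuation_ext le v nu).
Implicit Types (a b c : L) (f g h : {poly K}).
Notation lt x y := (~~ le y x).

(** Only bounds b in Lambda are used; the value oo satisfies all of them, so vanishing terms need no
    separate treatment. *)
Definition val_ge b f := vle le (Some b) (nu f).
Definition val_gt b f := vlt le (Some b) (nu f).
Notation nge := val_ge.
Notation ngt := val_gt.

Lemma nu0 : nu 0 = None. Proof. by case: val. Qed.

Lemma nu1 : nu 1 = Some 0. Proof. by case: val. Qed.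

Lemma nuM f g : nu (f * g) = vadd (nu f) (nu g). Proof. by case: val. Qed.

Lemma nuC (x : K) : nu x%:P = v x. Proof. by case: val. Qed.

Lemma nge_Some b a f : nu f = Some a -> nge b f = le b a.
Proof. by rewrite /nge => ->. Qed.

Lemma ngt_Some b a f : nu f = Some a -> ngt b f = lt b a.
Proof. by rewrite /ngt => ->. Qed.

Lemma nge_zero b : nge b 0. Proof. by rewrite /nge nu0. Qed.

Lemma ngt_zero b : ngt b 0. Proof. by rewrite /ngt nu0. Qed.

Lemma ngtW b f : ngt b f -> nge b f.
Proof. by rewrite /ngt /nge /vlt; case: (nu f) => //= a; apply: (lt_le ole). Qed.

Lemma nge_le b c f : le c b -> nge b f -> nge c f.
Proof. by rewrite /nge; case: (nu f) => //= a; apply: (le_tr ole). Qed.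

Lemma ngt_le b c f : le c b -> ngt b f -> ngt c f.
Proof. by rewrite /ngt /vlt; case: (nu f) => //= a; apply: (le_lt_tr ole). Qed.

Lemma nge_lt b c f : lt c b -> nge b f -> ngt c f.
Proof. by rewrite /ngt /nge /vlt; case: (nu f) => //= a; apply: (lt_le_tr ole). Qed.

Lemma ngeD b f g : nge b f -> nge b g -> nge b (f + g).
Proof.
case: val => _ _ _ /(_ f g) + _; rewrite /nge /vmin.
case: ifP => _; case: (nu (f + g)) => //= c.
  by case: (nu f) => //= a h h1 _; apply: (le_tr ole) h.
by case: (nu g) => //= a h _ h1; apply: (le_tr ole) h.
Qed.

Lemma ngtD b f g : ngt b f -> ngt b g -> ngt b (f + g).
Proof.
case: val => _ _ _ /(_ f g) + _; rewrite /ngt /vlt /vmin.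
case: ifP => _; case: (nu (f + g)) => //= c.
  by case: (nu f) => //= a h h1 _; apply: (lt_le_tr ole) h.
by case: (nu g) => //= a h _ h1; apply: (lt_le_tr ole) h.
Qed.

Lemma nuN f : nu (- f) = nu f.
Proof.
have h : nu (-1) = Some 0.
  have := nuM (-1) (-1); rewrite mulrNN mulr1 nu1.
  case: (nu (-1)) => //= c [e]; congr Some.
  by apply: (mulrn_eq0_torsion ole (isT : (0 < 2)%N)); rewrite mulr2n -e.
by rewrite -mulN1r nuM h; case: (nu f) => //= a; rewrite add0r.
Qed.

Lemma ngeN b f : nge b (- f) = nge b f. Proof. by rewrite /nge nuN. Qed.

Lemma ngtN b f : ngt b (- f) = ngt b f. Proof. by rewrite /ngt nuN. Qed.

Lemma ngeB b f g : nge b f -> nge b g -> nge b (f - g).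
Proof. by move=> hf hg; rewrite ngeD // ngeN. Qed.

Lemma ngtB b f g : ngt b f -> ngt b g -> ngt b (f - g).
Proof. by move=> hf hg; rewrite ngtD // ngtN. Qed.

Lemma ngeM b c f g : nge b f -> nge c g -> nge (b + c) (f * g).
Proof.
rewrite /nge nuM; case: (nu f) (nu g) => [a|] [a'|] //=; exact: (leD ole).
Qed.

Lemma ngt_ngeM b c f g : ngt b f -> nge c g -> ngt (b + c) (f * g).
Proof.
rewrite /nge /ngt /vlt nuM; case: (nu f) (nu g) => [a|] [a'|] //=.
exact: (lt_leD ole).
Qed.

Lemma nge_sum (I : Type) (r : seq I) (P : pred I) (H : I -> {poly K}) b :
  (forall i, P i -> nge b (H i)) -> nge b (\sum_(i <- r | P i) H i).
Proof. by move=> h; apply: (big_ind (nge b)) => //; [exact: nge_zero | exact: ngeD]. Qed.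

Lemma ngt_sum (I : Type) (r : seq I) (P : pred I) (H : I -> {poly K}) b :
  (forall i, P i -> ngt b (H i)) -> ngt b (\sum_(i <- r | P i) H i).
Proof. by move=> h; apply: (big_ind (ngt b)) => //; [exact: ngt_zero | exact: ngtD]. Qed.

Lemma ngeX b f n : nge b f -> nge (b *+ n) (f ^+ n).
Proof.
move=> h; elim: n => [|n ih]; first by rewrite expr0 mulr0n /nge nu1 /= (le_refl ole).
by rewrite exprS mulrS; apply: ngeM.
Qed.

Lemma nuX b f n : nu f = Some b -> nu (f ^+ n) = Some (b *+ n).
Proof.
move=> h; elim: n => [|n ih]; first by rewrite expr0 nu1.
by rewrite exprS mulrS nuM h ih.
Qed.

Lemma nge_nu b f : nu f = Some b -> nge b f.
Proof. by move/nge_Some->; apply: (le_refl ole). Qed.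

Lemma ngt_nuF b f : nu f = Some b -> ngt b f = false.
Proof. by move/ngt_Some->; rewrite (le_refl ole). Qed.

(** If f + g had value above b, so would f = (f + g) - g. *)
Lemma nu_dominant b f g : nu f = Some b -> ngt b g -> nu (f + g) = Some b.
Proof.
move=> hf hg; have h1 := ngeD (nge_nu hf) (ngtW hg).
have h2 : ~~ ngt b (f + g).
  apply/negP => h; move: (ngtB h hg); rewrite addrK.
  by rewrite (ngt_nuF hf).
move: h1 h2; rewrite /nge /ngt /vlt; case: (nu (f + g)) => //= a h1.
by rewrite negbK => h2; congr Some; apply: (le_asym ole h2).
Qed.

End Valuation.

(** * Levels as maxima of slopes *)

Section Levels.
Context {L : lmodType rat} (le : rel L) (ole : ordered_group le).
Implicit Types x y z : @ext L.

Lemma ext_le_refl x : ext_le le x x.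
Proof. by case: x => //= a; apply: (le_refl ole). Qed.

Lemma ext_le_tr x y z : ext_le le x y -> ext_le le y z -> ext_le le x z.
Proof. by case: x y z => [|a|] [|b|] [|c|] //=; apply: (le_tr ole). Qed.

Lemma ext_lt_le x y : ext_lt le x y -> ext_le le x y.
Proof. by rewrite /ext_lt; case: x y => [|a|] [|b|] //=; apply: (lt_le ole). Qed.

Lemma ext_le_max_l x y : ext_le le x (ext_max le x y).
Proof. by rewrite /ext_max; case: ifP => // _; apply: ext_le_refl. Qed.

Lemma ext_le_max_r x y : ext_le le y (ext_max le x y).
Proof.
rewrite /ext_max; case: ifP => h; first exact: ext_le_refl.
by apply: ext_lt_le; rewrite /ext_lt h.
Qed.

Lemma ext_le_bigmax (r : seq nat) (G : nat -> @ext L) s : s \in r ->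
  ext_le le (G s) (\big[ext_max le/MInf]_(i <- r) G i).
Proof.
elim: r => // t r ih; rewrite in_cons big_cons => /predU1P [->|/ih h].
  exact: ext_le_max_l.
exact: ext_le_tr h (ext_le_max_r _ _).
Qed.

Lemma bigmax_attained (r : seq nat) (G : nat -> @ext L) :
  \big[ext_max le/MInf]_(i <- r) G i = MInf \/
  exists2 s, s \in r & G s = \big[ext_max le/MInf]_(i <- r) G i.
Proof.
elim: r => [|t r ih]; first by left; rewrite big_nil.
rewrite big_cons {1 3}/ext_max; case: ifP => _.
  by case: ih => [->|[s hs e]]; [left | right; exists s; rewrite // in_cons hs orbT].
by right; exists t; rewrite // in_cons eqxx.
Qed.

End Levels.

(** * Key polynomials and division by nearby polynomials *)

Section KeyPolynomials.
Context {K : fieldType} {L : lmodType rat} (le : rel L).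
Context (v : K -> option L) (nu : {poly K} -> option L) (m : nat).
Hypotheses (ole : ordered_group le) (valK : is_valuation_K le v).
Hypotheses (val : is_valuation_ext le v nu) (m_gt0 : (0 < m)%N).
Implicit Types (a b c : L) (f g h : {poly K}).
Notation lt x y := (~~ le y x).
Notation nge := (val_ge le nu).
Notation ngt := (val_gt le nu).

(* [eps] is the level of [Q], and [s] an element of [I(Q)] *)
Record key_data (Q : {poly K}) (gamma eps : L) (s : nat) : Prop := KeyData {
  key_monic : Q \is monic;
  key_size : size Q = m.+1;
  key_nu : nu Q = Some gamma;
  key_small_fin : forall f, (size f <= m)%N -> nu f = None -> f = 0;
  key_small : forall f b i, (size f <= m)%N -> nge b f -> (0 < i)%N ->
    ngt (b - eps *+ i) f^`N(i);
  key_deriv : forall i, nge (gamma - eps *+ i) Q^`N(i);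
  key_s_gt0 : (0 < s)%N;
  key_exact : nu Q^`N(s) = Some (gamma - eps *+ s) }.

Lemma nu_const_fin (x : K) : x != 0 -> exists a, nu x%:P = Some a.
Proof.
move=> x0; rewrite (nuC val); case e: (v x) => [a|]; first by exists a.
by case: valK => /(_ x) [/(_ e) h]; rewrite h eqxx in x0.
Qed.

Lemma slope_le_level f s : (0 < s < size f)%N ->
  ext_le le (slope nu f s) (level le nu f).
Proof.
move=> h; rewrite /level leqNgt (leq_ltn_trans _ (proj2 (andP h))) /=; last by case/andP: h.
by apply: (ext_le_bigmax ole (slope nu f)); rewrite mem_index_iota.
Qed.

Lemma slope_lead f : slope nu f (size f).-1 =
  match nu f, nu (lead_coef f)%:P with
  | Some a, Some b => Fin (((size f).-1%:R : rat)^-1 *: (a - b))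
  | Some _, None => MInf
  | None, Some _ => PInf
  | None, None => MInf
  end.
Proof. by rewrite /slope nderivn_lead. Qed.

(** Clears denominators in the slopes: a comparison of levels becomes a family of bounds on the
    values of derivatives. *)
Lemma key_dataP Q gamma : Psi le nu m Q -> nu Q = Some gamma ->
  exists eps s, key_data Q gamma eps s.
Proof.
move=> [[Qmon Qkey] Qsize] Qnu.
have nz_lead f : f != 0 -> exists a, nu (lead_coef f)%:P = Some a.
  by move=> f0; apply: nu_const_fin; rewrite lead_coef_eq0.
have Q0 : Q != 0 by apply: monic_neq0.
(* The derivative of order m is the leading coefficient, so this slope is finite; hence the maximum
   is not -oo and is attained. *)
have hlead : exists c, slope nu Q m = Fin c.
  have := slope_lead Q; rewrite Qsize /= Qnu.
  by have [b ->] := nz_lead _ Q0 => ->; eexists.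
have hm : (0 < m < size Q)%N by rewrite Qsize m_gt0 ltnSn.
have [s [s_gt0 hs]] : exists s, (0 < s)%N /\ slope nu Q s = level le nu Q.
  have hle := slope_le_level hm; move: hle.
  rewrite /level Qsize ltnNge m_gt0 /=.
  case: (bigmax_attained le (index_iota 1 m.+1) (slope nu Q)) => [->|].
    by have [c ->] := hlead.
  by case=> s; rewrite mem_index_iota => /andP [s0 _] e _; exists s.
have [eps heps] : exists eps, level le nu Q = Fin eps.
  move: (slope_le_level hm); have [c ->] := hlead; rewrite -hs /slope Qnu.
  by case: (nu _) => // b _; eexists.
have lvl f : (size f <= m)%N -> ext_lt le (level le nu f) (Fin eps).
  by move=> fm; rewrite -heps; apply: Qkey; rewrite Qsize ltnS.
exists eps, s; split => //.
(* A nonzero constant has finite value; a nonconstant f of value oo has slope +oo at its degree, so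
   its level is not below [eps]. *)
- move=> f fm fnu; apply/eqP/negPn/negP => f0.
  have [sf|sf] := leqP (size f) 1.
    move: f0 fnu; rewrite (size1_polyC sf) polyC_eq0 => /nu_const_fin [a ->] //.
  have hsf : (0 < (size f).-1 < size f)%N by lia.
  move: (slope_le_level hsf) (lvl f fm); rewrite slope_lead fnu.
  by have [b ->] := nz_lead _ f0; rewrite /ext_lt; case: (level _ _ _).
- move=> f b i fm fb i0; have [sf|sf] := leqP (size f) i.
    by rewrite nderivn_poly0 // (ngt_zero val).
  have hsf : (0 < i < size f)%N by rewrite i0.
  move: (slope_le_level hsf) (lvl f fm); rewrite /slope.
  case e: (nu f^`N(i)) => [d|]; last by rewrite /ngt /vlt e.
  rewrite (ngt_Some _ _ e); move: fb; rewrite /nge.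
  case: (nu f) => [a|] /= fb; last by rewrite /ext_lt; case: (level _ _ _).
  case: (level _ _ _) => //= ep h1; rewrite /ext_lt /= => h2.
  have := ltMn ole i0 (le_lt_tr ole h1 h2); rewrite scale_natV // => h3.
  by apply: (lt_shift ole (lt_leD ole h3 fb)); zmod.
- case=> [|i]; first by rewrite nderivn0 mulr0n subr0; apply: (nge_nu ole).
  have [sf|sf] := leqP (size Q) i.+1.
    by rewrite nderivn_poly0 // (nge_zero val).
  have := @slope_le_level Q i.+1; rewrite sf => /(_ isT).
  rewrite heps /slope Qnu /nge; case e: (nu _) => [d|] //= h.
  have := leMn ole i.+1 h; rewrite scale_natV // => h'.
  by apply: (le_shift ole h'); zmod.
- move: hs; rewrite heps /slope Qnu; case: (nu _) => // d [<-].
  by rewrite scale_natV //; congr Some; zmod.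
Qed.

Lemma inGamma_div x n : (0 < n)%N -> inGamma v (x *+ n) -> inGamma v x.
Proof.
move=> n0 [k [k0 [y hy]]]; exists (n * k)%N; split; first by rewrite muln_gt0 n0.
by exists y; rewrite mulrnA.
Qed.

Lemma vX x n a : v x = Some a -> v (x ^+ n) = Some (a *+ n).
Proof. by rewrite -!(nuC val) rmorphXn; apply: (nuX val). Qed.

Lemma inGammaD x y : inGamma v x -> inGamma v y -> inGamma v (x + y).
Proof.
move=> [n [n0 [a [a0 va]]]] [k [k0 [b [b0 vb]]]].
exists (n * k)%N; rewrite muln_gt0 n0 k0; split=> //.
exists (a ^+ k * b ^+ n); rewrite mulf_neq0 ?expf_neq0 //; split=> //.
case: valK => _ -> _; rewrite (vX _ va) (vX _ vb) /=; congr Some.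
by rewrite mulrnDl !mulrnA [y *+ n *+ k]mulrnAC.
Qed.

Lemma inGammaN x : inGamma v x -> inGamma v (- x).
Proof.
move=> [n [n0 [a [a0 va]]]]; exists n; split=> //; exists a^-1; rewrite invr_eq0.
split=> //; have := nuM val a%:P a^-1%:P; rewrite -polyCM mulfV // (nu1 val).
rewrite !(nuC val) va; case: (v a^-1) => //= c [e]; congr Some.
by rewrite mulNrn; apply/eqP; rewrite -addr_eq0 addrC -e.
Qed.

Lemma inGammaMn x n : inGamma v x -> inGamma v (x *+ n).
Proof.
move=> h; elim: n => [|n ih]; last by rewrite mulrS; apply: inGammaD.
by rewrite mulr0n -(subrr x); apply: inGammaD => //; apply: inGammaN.
Qed.

Section OneKey.
Context (Q : {poly K}) (gamma eps : L) (s : nat) (kd : key_data Q gamma eps s).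

(** Equivalently, f(x + y) has value at least b in the Gauss extension of nu giving y the weight
    [eps]; this is why the condition is multiplicative. *)
Definition tame b f := forall i, nge (b - eps *+ i) f^`N(i).

Lemma tame_small b f : (size f <= m)%N -> nge b f -> tame b f.
Proof.
move=> fm fb [|i]; first by rewrite nderivn0 mulr0n subr0.
by apply: (ngtW ole); apply: (key_small kd).
Qed.

Lemma tame_le b c f : le c b -> tame b f -> tame c f.
Proof. by move=> h hf i; apply: (nge_le ole _ (hf i)); apply: (le_shift ole h); zmod. Qed.

Lemma tameM b c f g : tame b f -> tame c g -> tame (b + c) (f * g).
Proof.
move=> hf hg i; rewrite nderivnM; apply: (nge_sum ole val) => j _.
have -> : b + c - eps *+ i = (b - eps *+ j) + (c - eps *+ (i - j)).
  have -> : eps *+ i = eps *+ j + eps *+ (i - j).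
    by rewrite -mulrnDr subnKC // -ltnS.
  move: (i - j)%N => k; zmod.
exact: (ngeM ole val).
Qed.

(** Differentiating a factor of degree below m gains value strictly, so up to terms of larger value
    f acts as a constant. *)
Lemma leibniz_small b c f g n : (size f <= m)%N -> nge b f -> tame c g ->
  exists2 d, (f * g)^`N(n) = f * g^`N(n) + d & ngt (b + c - eps *+ n) d.
Proof.
move=> fm fb hg; rewrite nderivnM big_ord_recl nderivn0 subn0 /=.
eexists; first by [].
apply: (ngt_sum ole val) => i _; rewrite /bump leq0n add1n.
have -> : b + c - eps *+ n = (b - eps *+ i.+1) + (c - eps *+ (n - i.+1)).
  have -> : eps *+ n = eps *+ i.+1 + eps *+ (n - i.+1).
    by rewrite -mulrnDr subnKC.
  move: (n - i.+1)%N => k; zmod.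
by apply: (ngt_ngeM ole val) => //; apply: (key_small kd).
Qed.

Lemma small_value f : (size f <= m)%N -> f != 0 -> exists a, nu f = Some a.
Proof.
move=> fm f0; case e: (nu f) => [a|]; first by exists a.
by rewrite (key_small_fin kd fm e) eqxx in f0.
Qed.

Section Carry.
Context (R : {poly K}).
Hypotheses (Rmon : R \is monic) (sizeR : size R = m.+1).
Hypotheses (sizeRQ : (size (R - Q)%R <= m)%N) (nuRQ : nge gamma (R - Q)).

Let R_eq : R = Q + (R - Q). Proof. by rewrite addrC subrK. Qed.

Lemma tame_near : tame gamma R.
Proof.
move=> i; rewrite R_eq nderivnD; apply: (ngeD ole val); first exact: (key_deriv kd).
exact: tame_small.
Qed.

(** The derivative of R - Q, of degree below m, has strictly larger value than that of Q. *)
Lemma exact_near : nu R^`N(s) = Some (gamma - eps *+ s).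
Proof.
rewrite R_eq nderivnD; apply: (nu_dominant ole val (key_exact kd)).
exact: (key_small kd _ _ (key_s_gt0 kd)).
Qed.

(* Apply the s-th derivative to f * g = q * R + r: if nu q + gamma were smaller
   than nu (f * g), the value of the s-th derivative of q * R would be
   nu q + gamma - s * eps, but both other terms have larger derivatives. *)
Lemma carry f g b : (size f <= m)%N -> (size g <= m)%N -> nge b (f * g) ->
  nge b ((f * g) %% R) /\ nge (b - gamma) ((f * g) %/ R).
Proof.
move=> fm gm hb; set q := _ %/ R; set r := _ %% R.
have e : f * g = q * R + r by apply: divp_eq.
have qm : (size q <= m)%N.
  rewrite /q (size_quo Rmon sizeR); have := size_polyMleq f g; lia.
have rm : (size r <= m)%N by rewrite -ltnS -sizeR ltn_modp monic_neq0.
suff hq : nge (b - gamma) q.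
  split=> //; have -> : r = f * g - q * R by rewrite e addrC addKr.
  apply: (ngeB ole val) => //; have := ngeM ole val hq (tame_near 0).
  by rewrite nderivn0 mulr0n subr0 subrK.
have [q0|q0] := eqVneq q 0; first by rewrite q0 (nge_zero val).
have [w nuq] := small_value qm q0; rewrite (nge_Some _ _ nuq).
apply/negPn/negP => hw.
have qR : nge (w + gamma) (q * R).
  have := ngeM ole val (nge_nu ole nuq) (tame_near 0).
  by rewrite nderivn0 mulr0n subr0.
have hwb : lt (w + gamma) b by apply: (lt_shift ole hw); zmod.
have rw : nge (w + gamma) r.
  have -> : r = f * g - q * R by rewrite e addrC addKr.
  by apply: (ngeB ole val) => //; apply: (nge_le ole (lt_le ole hwb)).
have hfg : tame b (f * g).
  have [->|f0] := eqVneq f 0; first by move=> i; rewrite mul0r raddf0 (nge_zero val).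
  have [->|g0] := eqVneq g 0; first by move=> i; rewrite mulr0 raddf0 (nge_zero val).
  have [a nuf] := small_value fm f0; have [c nug] := small_value gm g0.
  apply: (@tame_le (a + c)); first by move: hb; rewrite /nge (nuM val) nuf nug.
  by apply: tameM; apply: tame_small => //; apply: (nge_nu ole).
have [d ed hd] := leibniz_small s qm (nge_nu ole nuq) tame_near.
(* This difference equals q times the s-th derivative of R, whose value is exactly w + gamma - s
   eps. *)
have h1 : ngt (w + gamma - eps *+ s) ((f * g)^`N(s) - r^`N(s) - d).
  apply: (ngtB ole val) => //; apply: (ngtB ole val).
    by apply: (nge_lt ole _ (hfg s)); apply: (lt_shift ole hwb); zmod.
  exact: (key_small kd rm rw (key_s_gt0 kd)).
move: h1; rewrite e nderivnD ed addrK addrK.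
rewrite (@ngt_nuF _ _ le nu ole) //.
by rewrite (nuM val) nuq exact_near /=; congr Some; zmod.
Qed.

End Carry.

(* A small f of minimal degree with nu f outside Gamma would make the two
   terms of any division h = q * f + r have distinct values. For h = Q the s-th
   derivative shows that this is impossible. *)
Lemma small_inGamma f a : (size f <= m)%N -> nu f = Some a -> inGamma v a.
Proof.
elim/ltn_ind: {f}(size f) {-2}f a (erefl (size f)) => n ih f a sf fm nuf.
have [sf1|sf1] := leqP (size f) 1.
  move: nuf; rewrite (size1_polyC sf1) (nuC val) => vf.
  exists 1%N; split=> //; exists f`_0; split=> //.
  by apply/eqP => e; case: valK => /(_ f`_0) [_ /(_ e)]; rewrite vf.
apply: NNPP => aG; have f0 : f != 0 by rewrite -size_poly_gt0; lia.
(* Equality would put (i+1) a = nu(r) - c, hence a, into Gamma, as r has smaller degree than f. *)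
have neq q (r : {poly K}) i c : nu q = Some (c + a *+ i) -> inGamma v c ->
    (size r < size f)%N -> nu (q * f) <> nu r.
  move=> nuq cG rf; rewrite (nuM val) nuq nuf /= => /esym nur; apply: aG.
  have rG : inGamma v (c + a *+ i + a).
    by apply: (ih (size r) _ r) => //; rewrite -?sf // (leq_trans (ltnW rf)).
  apply: (@inGamma_div _ i.+1) => //.
  have -> : a *+ i.+1 = (c + a *+ i + a) + - c by zmod.
  by apply: inGammaD => //; apply: inGammaN.
have min q r : nu (q * f) <> nu r ->
    nu (q * f + r) = nu (q * f) /\ (forall b, nge b (q * f + r) -> nge b r) \/
    nu (q * f + r) = nu r /\ (forall b, nge b (q * f + r) -> nge b (q * f)).
  set p := q * f; case ep : (nu p) => [x|]; case er : (nu r) => [y|] // hne.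
  - have [hxy|hxy] := boolP (le x y); [left|right].
    + have hy : ngt x r.
        rewrite (ngt_Some _ _ er); apply/negP => h; apply: hne; congr Some.
        exact: (le_asym ole).
      have e := nu_dominant ole val ep hy; split=> // b.
      by rewrite (nge_Some _ _ e) => /(le_tr ole) h; rewrite (nge_Some _ _ er) h.
    + have hx : ngt y p by rewrite (ngt_Some _ _ ep).
      have e := nu_dominant ole val er hx; rewrite addrC; split=> // b.
      rewrite (nge_Some _ _ e) (nge_Some _ _ ep) => /(le_tr ole); apply.
      exact: (lt_le ole).
  - left; have hr : ngt x r by rewrite /ngt /vlt er.
    by split=> [|b]; [apply: (nu_dominant ole val ep) | rewrite /nge er].
  - right; have hr : ngt y p by rewrite /ngt /vlt ep.
    by rewrite addrC; split=> [|b]; [apply: (nu_dominant ole val er) | rewrite /nge ep].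
have hmod h : (size (h %% f)%R < size f)%N by rewrite ltn_modp.
(* Repeated division by f puts all values in degree below m into Gamma + N a, the form that [neq]
   requires of quotients. *)
have values k (h : {poly K}) : (size h < k)%N -> (size h <= m)%N -> h != 0 ->
    exists i c, inGamma v c /\ nu h = Some (c + a *+ i).
  elim: k h => // k ihk h hk hm h0.
  have [y nuh] := small_value hm h0; rewrite nuh.
  have [q0|q0] := eqVneq (h %/ f) 0.
    have e : h = h %% f by rewrite {1}(divp_eq h f) q0 mul0r add0r.
    exists 0%N, y; rewrite mulr0n addr0; split=> //.
    by apply: (ih (size h) _ h) => //; rewrite -sf e.
  have sq : (size (h %/ f)%R < size h)%N.
    by rewrite size_divp // ltn_subrL -subn1 subn_gt0 sf1 size_poly_gt0.
  have [i [c [cG nuq]]] := ihk (h %/ f) (leq_trans sq hk) (ltnW (leq_trans sq hm)) q0.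
  have := min _ _ (neq _ (h %% f) _ _ nuq cG (hmod h)).
  rewrite -divp_eq nuh => -[[e _]|[e _]].
    exists i.+1, c; split=> //; rewrite e (nuM val) nuq nuf /=; congr Some; zmod.
  exists 0%N, y; rewrite mulr0n addr0; split=> //.
  apply: (ih (size (h %% f)) _ (h %% f)) => //; first by rewrite -sf hmod.
  by apply: leq_trans (ltnW (hmod h)) fm.
have Q0 : Q != 0 := monic_neq0 (key_monic kd).
set q := Q %/ f; set r := Q %% f.
have eQ : Q = q * f + r := divp_eq Q f.
have qm : (size q <= m)%N.
  by rewrite /q size_divp // (key_size kd) leq_subLR -add1n leq_add2r -subn1 subn_gt0.
have q0 : q != 0.
  by rewrite /q divp_eq0 negb_or Q0 negb_or f0 -leqNgt (key_size kd) leqW.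
have [i [c [cG nuq]]] := values _ _ (leqnn _) qm q0.
have [h1 h2] : nge gamma (q * f) /\ nge gamma r.
  have := nge_nu ole (key_nu kd).
  case: (min _ _ (neq _ r _ _ nuq cG (hmod Q))); rewrite -eQ => -[e h] hg.
    by split; [rewrite /nge -e | apply: h].
  by split; [apply: h | rewrite /nge -e].
have rm : (size r <= m)%N by apply: leq_trans (ltnW (hmod Q)) fm.
have [d ed hd] := leibniz_small s qm (nge_nu ole nuq) (tame_small fm (nge_nu ole nuf)).
have hle : le gamma (c + a *+ i + a).
  by move: h1; rewrite /nge (nuM val) nuq nuf.
have s0 := key_s_gt0 kd.
(* Both summands of Q have value at least gamma and factors of degree below m, so their s-th
   derivatives are too large for [key_exact]. *)
have h3 : ngt (gamma - eps *+ s) ((q * f)^`N(s) + r^`N(s)).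
  apply: (ngtD ole val); last exact: (key_small kd).
  have hle' : le (gamma - eps *+ s) (c + a *+ i + a - eps *+ s).
    by apply: (le_shift ole hle); zmod.
  apply: (ngt_le ole hle'); rewrite ed; apply: (ngtD ole val) => //.
  have := ngt_ngeM ole val (key_small kd fm (nge_nu ole nuf) s0) (nge_nu ole nuq).
  by rewrite mulrC; apply: (ngt_le ole); rewrite -(addrA (_ + _)) addrC (le_refl ole).
by move: h3; rewrite -nderivnD -eQ (ngt_nuF ole (key_exact kd)).
Qed.

End OneKey.
End KeyPolynomials.

(** * Weighted values of expansions *)

Section WeightedValue.
Context {K : fieldType} {L : lmodType rat} (le : rel L).
Context (v : K -> option L) (nu : {poly K} -> option L) (m : nat).
Hypotheses (ole : ordered_group le) (val : is_valuation_ext le v nu).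
Hypothesis (m_gt0 : (0 < m)%N).
Implicit Types (a b c lam mu : L) (f g h Q R : {poly K}).
Notation nge := (val_ge le nu).
Notation ngt := (val_gt le nu).

(** For lam = nu(R) this says nu_R(h) >= b; a free weight allows expansions in different R to be
    compared at a common weight. *)
Definition wval_ge R lam b h := forall i, nge (b - lam *+ i) (qcoef R h i).
Notation wge := wval_ge.

Definition carry_bound lam R := forall f g b,
  (size f <= m)%N -> (size g <= m)%N -> nge b (f * g) ->
  nge b ((f * g) %% R) /\ nge (b - lam) ((f * g) %/ R).

Lemma vle_bigmin n (H : 'I_n -> option L) x :
  vle le x (\big[vmin le/None]_i H i) <-> forall i, vle le x (H i).
Proof.
have vle_tr y z w : vle le y z -> vle le z w -> vle le y w.
  by case: y z w => [y|] [z|] [w|] //=; apply: (le_tr ole).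
have vle_min : {morph vle le x : y z / vmin le y z >-> y && z}.
  move=> y z; rewrite /vmin; case: ifP => hyz.
    case: (boolP (vle le x y)) => //= hb; apply/esym; exact: vle_tr hyz.
  case: (boolP (vle le x z)) => [hb|]; last by rewrite andbF.
  rewrite andbT; apply/esym; apply: (vle_tr _ z) => //.
  by case: y z hyz {hb} => [y|] [z|] //= h; apply: (lt_le ole); rewrite h.
rewrite (big_morph _ vle_min (id1 := true)) ?big_andE; first by split=> /forallP.
by case: x {vle_min}.
Qed.

Section Basic.
Context (R : {poly K}) (lam : L) (Rmon : R \is monic) (sizeR : size R = m.+1).

Lemma wge_le b c h : le c b -> wge R lam b h -> wge R lam c h.
Proof.
by move=> hc hb i; apply: (nge_le ole _ (hb i)); apply: (le_shift ole hc); zmod.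
Qed.

Lemma wge_zero b : wge R lam b 0.
Proof. by move=> i; rewrite qcoef_eq0; apply: (nge_zero val). Qed.

Lemma wgeD b f g : wge R lam b f -> wge R lam b g -> wge R lam b (f + g).
Proof. by move=> hf hg i; rewrite qcoefD; apply: (ngeD ole val). Qed.

Lemma wge_sum (I : Type) (r : seq I) (P : pred I) (H : I -> {poly K}) b :
  (forall i, P i -> wge R lam b (H i)) -> wge R lam b (\sum_(i <- r | P i) H i).
Proof. by move=> h; apply: (big_ind (wge R lam b)) => //; [exact: wge_zero | exact: wgeD]. Qed.

Lemma wgeMn b f n : wge R lam b f -> wge R lam b (f *+ n).
Proof. by move=> h; rewrite -[n]card_ord -sumr_const; apply: wge_sum. Qed.

Lemma wge_small b f : (size f <= m)%N -> nge b f -> wge R lam b f.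
Proof.
move=> fm hf [|i]; rewrite (qcoef_small sizeR) ?mulr0n ?subr0 //.
exact: (nge_zero val).
Qed.

Lemma wgeMR b f : wge R lam b f -> wge R lam (b + lam) (f * R).
Proof.
move=> hf [|i]; rewrite (qcoefM Rmon); first exact: (nge_zero val).
by have -> : b + lam - lam *+ i.+1 = b - lam *+ i by zmod.
Qed.

Lemma wgeMRX b f n : wge R lam b f -> wge R lam (b + lam *+ n) (f * R ^+ n).
Proof.
move=> hf; elim: n => [|n ih]; first by rewrite mulr0n addr0 mulr1.
by rewrite exprSr mulrSr addrA mulrA; apply: wgeMR.
Qed.

Lemma wge1 : wge R lam 0 1.
Proof.
by apply: wge_small; rewrite ?size_poly1 //; apply: (nge_nu ole); apply: (nu1 val).
Qed.

Lemma wge_self : wge R lam lam R.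
Proof. by have := wgeMR wge1; rewrite mul1r add0r. Qed.

Hypothesis Rcarry : carry_bound lam R.

(** By bilinearity only products of two polynomials of degree below m matter; one division by R
    gives their whole expansion, and [Rcarry] bounds both coefficients. *)
Lemma wgeM b c f g : wge R lam b f -> wge R lam c g -> wge R lam (b + c) (f * g).
Proof.
have small2 b' c' f' g' : (size f' <= m)%N -> (size g' <= m)%N -> nge b' f' ->
    nge c' g' -> wge R lam (b' + c') (f' * g').
  move=> fm gm hf hg; have [hr hq] := Rcarry fm gm (ngeM ole val hf hg).
  rewrite (divp_eq (f' * g') R); apply: wgeD.
    rewrite -[X in wge _ _ X _](subrK lam); apply: wgeMR; apply: wge_small => //.
    rewrite (size_quo Rmon sizeR); have := size_polyMleq f' g'; lia.
  by apply: wge_small => //; rewrite -ltnS -sizeR ltn_modp monic_neq0.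
move=> hf hg; rewrite (qcoef_expand m_gt0 Rmon sizeR (leqnn (size f))).
rewrite (qcoef_expand m_gt0 Rmon sizeR (leqnn (size g))) mulr_suml.
apply: wge_sum => i _; rewrite mulr_sumr; apply: wge_sum => j _.
rewrite mulrACA -exprD.
have -> : b + c = (b - lam *+ i) + (c - lam *+ j) + lam *+ (i + j) by zmod.
by apply: wgeMRX; apply: small2 => //; apply: (size_qcoef Rmon sizeR).
Qed.

Lemma wgeX b f n : wge R lam b f -> wge R lam (b *+ n) (f ^+ n).
Proof.
move=> hf; elim: n => [|n ih]; first exact: wge1.
by rewrite exprS mulrS; apply: wgeM.
Qed.

(** The i-th coefficient of the derivative is an integer multiple of coefficient k+i of A, and h^i
    makes up for i of the k+i weights mu. *)
Lemma wge_horner (A : {poly {poly K}}) b mu h k :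
  (forall j, (size (A`_j)%R <= m)%N) -> (forall j, nge (b - mu *+ j) A`_j) ->
  wge R lam mu h -> wge R lam (b - mu *+ k) A^`N(k).[h].
Proof.
move=> sA hA hh; rewrite horner_coef; apply: wge_sum => i _.
have -> : b - mu *+ k = (b - mu *+ (k + i)) + mu *+ i by zmod.
apply: wgeM; last exact: wgeX.
by rewrite coef_nderivn; apply: wgeMn; apply: wge_small.
Qed.

End Basic.

(** The Q-expansion with Q replaced by a variable, so that a change of base is a Taylor
    expansion. *)
Definition qpoly Q h : {poly {poly K}} := \poly_(j < size h) qcoef Q h j.

Section Expansion.
Context (Q : {poly K}) (Qmon : Q \is monic) (sizeQ : size Q = m.+1).

Lemma coef_qpoly h j : (qpoly Q h)`_j = qcoef Q h j.
Proof.
by rewrite coef_poly; case: ltnP => // hj; rewrite (qcoef_big m_gt0 Qmon sizeQ).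
Qed.

Lemma size_coef_qpoly h j : (size ((qpoly Q h)`_j)%R <= m)%N.
Proof. by rewrite coef_qpoly (size_qcoef Qmon sizeQ). Qed.

Lemma horner_qpoly h : (qpoly Q h).[Q] = h.
Proof. by rewrite horner_poly -(qcoef_expand m_gt0 Qmon sizeQ). Qed.

Lemma wge_transfer R lam b h : R \is monic -> size R = m.+1 -> carry_bound lam R ->
  (size (Q - R)%R <= m)%N -> nge lam (Q - R) -> wge Q lam b h -> wge R lam b h.
Proof.
move=> Rmon sizeR Rcarry sQR nQR hh.
rewrite -(horner_qpoly h) -[qpoly Q h]nderivn0.
have -> : b = b - lam *+ 0 by zmod.
apply: (wge_horner Rmon sizeR Rcarry 0 (size_coef_qpoly h)) => [j|].
  by rewrite coef_qpoly.
rewrite -(subrK R Q); apply: wgeD; last exact: (wge_self lam Rmon sizeR).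
exact: (wge_small _ sizeR).
Qed.

Lemma wge_weight lam mu b h : le lam mu -> wge Q lam b h -> wge Q mu b h.
Proof.
move=> hl hh i; apply: (nge_le ole _ (hh i)).
by apply: (le_shift ole (leMn ole i hl)); zmod.
Qed.

(** Nonzero coefficients have index below size h, which bounds the loss. *)
Lemma wge_weight_down lam mu b h : le lam mu -> wge Q mu b h ->
  wge Q lam (b - (mu - lam) *+ size h) h.
Proof.
move=> hl hh i; have [hi|hi] := leqP (size h) i.
  by rewrite (qcoef_big m_gt0 Qmon sizeQ hi); apply: (nge_zero val).
apply: (nge_le ole _ (hh i)).
have h0 : le 0 (mu - lam) by apply: (le_shift ole hl); zmod.
by apply: (le_shift ole (le_mulrn_mono ole h0 (ltnW hi))); zmod.
Qed.

Lemma wge_nge gamma b h : nge gamma Q -> wge Q gamma b h -> nge b h.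
Proof.
move=> hQ hh; rewrite (qcoef_expand m_gt0 Qmon sizeQ (leqnn (size h))).
apply: (nge_sum ole val) => i _.
have -> : b = (b - gamma *+ i) + gamma *+ i by zmod.
by apply: (ngeM ole val) => //; apply: (ngeX ole val).
Qed.

Lemma vle_nuQ gamma b h : nu Q = Some gamma ->
  vle le (Some b) (nuQ le nu Q h) <-> wge Q gamma b h.
Proof.
move=> Qnu.
have term i : vle le (Some b) (nu (qcoef Q h i * Q ^+ i)) =
    nge (b - gamma *+ i) (qcoef Q h i).
  rewrite /nge (nuM val) (nuX val i Qnu); case: (nu _) => //= a.
  by apply/idP/idP => hb; apply: (le_shift ole hb); zmod.
rewrite vle_bigmin.
split=> [hh i | hh i]; last by rewrite term.
(* The minimum in [nuQ] stops at size h; later coefficients vanish. *)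
have [hi|hi] := leqP (size h) i.
  by rewrite (qcoef_big m_gt0 Qmon sizeQ hi); apply: (nge_zero val).
by have := hh (Ordinal hi); rewrite term.
Qed.

End Expansion.

Lemma nuQ_fin Q gamma h : Q \is monic -> size Q = m.+1 -> nu Q = Some gamma ->
  (forall f, (size f <= m)%N -> nu f = None -> f = 0) -> h != 0 ->
  exists b, nuQ le nu Q h = Some b.
Proof.
move=> Qmon sizeQ Qnu fin h0; case e : (nuQ le nu Q h) => [b|]; first by exists b.
case/eqP: h0; rewrite (qcoef_expand m_gt0 Qmon sizeQ (leqnn (size h))).
apply: big1 => i _; rewrite (fin (qcoef Q h i)) ?mul0r //.
  exact: (size_qcoef Qmon sizeQ).
have /vle_bigmin/(_ i) : vle le None (nuQ le nu Q h) by rewrite e.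
by rewrite (nuM val) (nuX val i Qnu); case: (nu _).
Qed.

End WeightedValue.

(** * The cofinal family of key polynomials *)

Section Family.
Context {K : fieldType} {L : lmodType rat} (le : rel L).
Context (v : K -> option L) (nu : {poly K} -> option L) (m : nat).
Context (Qs : {poly K} -> Prop).
Hypotheses (ole : ordered_group le) (valK : is_valuation_K le v).
Hypotheses (val : is_valuation_ext le v nu) (m_gt0 : (0 < m)%N).
Hypothesis Psi_ex : exists Q, Psi le nu m Q.
Hypothesis Psi_nomax : forall Q, Psi le nu m Q ->
  exists R, Psi le nu m R /\ vlt le (nu Q) (nu R).
Hypothesis Qs_Psi : forall Q, Qs Q -> Psi le nu m Q.
Hypothesis Qs_cofinal : forall P, Psi le nu m P ->
  exists Q, Qs Q /\ vle le (nu P) (nu Q).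
Implicit Types (a b c : L) (f g h P Q R S : {poly K}).
Notation lt x y := (~~ le y x).
Notation nge := (val_ge le nu).
Notation ngt := (val_gt le nu).
Notation wge := (wval_ge le nu).

Definition mem_at Q gamma := Qs Q /\ nu Q = Some gamma.

Lemma Psi_fin Q : Psi le nu m Q -> exists gamma, nu Q = Some gamma.
Proof.
move=> /Psi_nomax [R [_]]; rewrite /vlt; case: (nu Q) => [g _|]; first by exists g.
by case: (nu R).
Qed.

Lemma mem_at_of Q : Qs Q -> exists gamma, mem_at Q gamma.
Proof. by move=> QQ; have [g e] := Psi_fin (Qs_Psi QQ); exists g. Qed.

Lemma mem_at_ex : exists Q gamma, mem_at Q gamma.
Proof.
by have [P /Qs_cofinal [Q [QQ _]]] := Psi_ex; have [g h] := mem_at_of QQ; exists Q, g.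
Qed.

Lemma mem_at_nomax Q gamma : mem_at Q gamma ->
  exists R rho, mem_at R rho /\ lt gamma rho.
Proof.
move=> [QQ nuQ]; have [P [PP]] := Psi_nomax (Qs_Psi QQ).
have [p nuP] := Psi_fin PP; have [R [RQ]] := Qs_cofinal PP.
have [r hr] := mem_at_of RQ; rewrite nuQ nuP (proj2 hr) /vlt /= => h1 h2.
by exists R, r; split=> //; apply: (lt_le_tr ole h2).
Qed.

Lemma mem_at_max Q gamma R rho : mem_at Q gamma -> mem_at R rho ->
  exists S sigma, [/\ mem_at S sigma, le gamma sigma & le rho sigma].
Proof.
move=> hQ hR; have [h|h] := boolP (le gamma rho).
  by exists R, rho; split=> //; apply: (le_refl ole).
by exists Q, gamma; split=> //; [apply: (le_refl ole) | apply: (lt_le ole)].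
Qed.

Lemma eventuallyP (P : {poly K} -> Prop) : eventually le nu Qs P <->
  exists Q0 c0, mem_at Q0 c0 /\ forall Q c, mem_at Q c -> le c0 c -> P Q.
Proof.
split=> [[Q0 [QQ0 h]]|[Q0 [g0 [[QQ0 nuQ0] h]]]].
  have [g0 h0] := mem_at_of QQ0; exists Q0, g0; split=> // Q g [QQ nuQ] hg.
  by apply: h => //; rewrite nuQ (proj2 h0).
exists Q0; split=> // Q QQ; have [g [_ nuQ]] := mem_at_of QQ.
by rewrite nuQ nuQ0 => hg; apply: (h _ g).
Qed.

Lemma mem_at_key Q gamma : mem_at Q gamma ->
  exists eps s, key_data le nu m Q gamma eps s.
Proof. by move=> [QQ nuQ]; apply: (key_dataP ole valK val m_gt0 (Qs_Psi QQ)). Qed.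

Lemma mem_at_monic Q gamma : mem_at Q gamma -> Q \is monic.
Proof. by move=> /mem_at_key [e [s kd]]; apply: (key_monic kd). Qed.

Lemma mem_at_size Q gamma : mem_at Q gamma -> size Q = m.+1.
Proof. by move=> /mem_at_key [e [s kd]]; apply: (key_size kd). Qed.

Lemma small_fin f : (size f <= m)%N -> nu f = None -> f = 0.
Proof.
have [Q [g /mem_at_key [e [s kd]]]] := mem_at_ex; exact: (key_small_fin kd).
Qed.

Lemma small_Gamma f a : (size f <= m)%N -> nu f = Some a -> inGamma v a.
Proof.
have [Q [g /mem_at_key [e [s kd]]]] := mem_at_ex.
exact: (small_inGamma ole valK val m_gt0 kd).
Qed.

Lemma mem_at_near Q gamma R rho : mem_at Q gamma -> mem_at R rho -> le gamma rho ->
  (size (R - Q)%R <= m)%N /\ nge gamma (R - Q).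
Proof.
move=> hQ hR hl; split.
  apply/leq_sizeP => j; rewrite leq_eqVlt coefB => /predU1P [<-|hj].
    have /eqP := mem_at_monic hQ; have /eqP := mem_at_monic hR.
    by rewrite !lead_coefE (mem_at_size hQ) (mem_at_size hR) /= => -> ->; rewrite subrr.
  by rewrite !nth_default ?subrr // ?(mem_at_size hQ) ?(mem_at_size hR).
apply: (ngeB ole val); last exact: (nge_nu ole (proj2 hQ)).
by rewrite (nge_Some _ _ (proj2 hR)).
Qed.

(** The weight is gamma and not nu(R): the derivatives of Q control division by R, because R - Q has
    degree below m and value at least gamma. *)
Lemma mem_at_carry Q gamma R rho : mem_at Q gamma -> mem_at R rho -> le gamma rho ->
  carry_bound le nu m gamma R.
Proof.
move=> hQ hR hl f g b fm gm; have [e [s kd]] := mem_at_key hQ.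
have [h1 h2] := mem_at_near hQ hR hl.
exact: (carry ole val m_gt0 kd (mem_at_monic hR) (mem_at_size hR) h1 h2).
Qed.

Lemma wge_up Q gamma R rho b h : mem_at Q gamma -> mem_at R rho -> le gamma rho ->
  wge Q gamma b h -> wge R gamma b h.
Proof.
move=> hQ hR hl; have [h1 h2] := mem_at_near hQ hR hl.
apply: (wge_transfer ole val m_gt0 (mem_at_monic hQ) (mem_at_size hQ)
  (mem_at_monic hR) (mem_at_size hR) (mem_at_carry hQ hR hl)).
  by rewrite size_subC.
by rewrite -(ngeN ole val) opprB.
Qed.

Lemma wge_down Q gamma R rho b h : mem_at Q gamma -> mem_at R rho -> le gamma rho ->
  wge R gamma b h -> wge Q gamma b h.
Proof.
move=> hQ hR hl; have [h1 h2] := mem_at_near hQ hR hl.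
exact: (wge_transfer ole val m_gt0 (mem_at_monic hR) (mem_at_size hR)
  (mem_at_monic hQ) (mem_at_size hQ) (mem_at_carry hQ hQ (le_refl ole _)) h1 h2).
Qed.

Lemma wge_mono Q gamma R rho b h : mem_at Q gamma -> mem_at R rho -> le gamma rho ->
  wge Q gamma b h -> wge R rho b h.
Proof. by move=> hQ hR hl /(wge_up hQ hR hl); apply: (wge_weight ole). Qed.

(** For R of larger value, gamma is the value of Q - R, which has degree below m. *)
Lemma mem_at_Gamma Q gamma : mem_at Q gamma -> inGamma v gamma.
Proof.
move=> hQ; have [R [rho [hR hlt]]] := mem_at_nomax hQ.
have [h1 _] := mem_at_near hQ hR (lt_le ole hlt).
apply: (@small_Gamma (Q - R)); first by rewrite size_subC.
apply: (nu_dominant ole val (proj2 hQ)).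
by rewrite (ngtN ole val) (ngt_Some _ _ (proj2 hR)).
Qed.

(** Taylor expansion at S with increment R - S: each factor R - S has value at least rho, while each
    derivative costs only gamma. *)
Lemma qcoef_cauchy Q gamma R rho S sigma b h l :
  mem_at Q gamma -> mem_at R rho -> mem_at S sigma -> le gamma rho -> le rho sigma ->
  wge Q gamma b h ->
  nge (b - gamma *+ l + (rho - gamma)) (qcoef S h l - qcoef R h l).
Proof.
move=> hQ hR hS hQR hRS hh; have hQS := le_tr ole hQR hRS.
have [Rm sR] := (mem_at_monic hR, mem_at_size hR).
have [Sm sS] := (mem_at_monic hS, mem_at_size hS).
have hc := mem_at_carry hQ hS hQS.
have {}hh := wge_up hQ hR hQR hh.
set A := qpoly R h.
have sA j : (size (A`_j)%R <= m)%N by apply: (size_coef_qpoly m_gt0 Rm sR).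
have hA : h = A.[S + (R - S)] by rewrite subrKC (horner_qpoly m_gt0 Rm sR).
(* The coefficients of A have degree below m, so A.[S] is already an S-expansion. *)
have -> : qcoef R h l = qcoef S A.[S] l.
  by rewrite (qcoef_horner Sm sS) // (coef_qpoly m_gt0 Rm sR).
rewrite -qcoefN -qcoefD; set d := h - _.
suff hd : wge S gamma (b + (rho - gamma)) d.
  by have := hd l; apply: (nge_le ole); apply: (le_shift ole (le_refl ole 0)); zmod.
have -> : d = \sum_(i < size A) A^`N(i.+1).[S] * (R - S) ^+ i.+1.
  rewrite /d {1}hA (@nderiv_taylor_wide _ (size A).+1) //; last exact: mulrC.
  by rewrite big_ord_recl nderivn0 expr0 mulr1 addrC addKr.
apply: (wge_sum ole val) => i _.
have h1 : wge S gamma (b - gamma *+ i.+1) A^`N(i.+1).[S].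
  apply: (wge_horner ole val m_gt0 Sm sS hc) => //; last exact: (wge_self ole val m_gt0).
  by move=> j; rewrite (coef_qpoly m_gt0 Rm sR).
have h2 : wge S gamma (rho *+ i.+1) ((R - S) ^+ i.+1).
  apply: (wgeX ole val m_gt0 Sm sS hc).
  have [n1 n2] := mem_at_near hR hS hRS.
  by apply: (wge_small val _ sS); [rewrite size_subC | rewrite -(ngeN ole val) opprB].
have := wgeM ole val m_gt0 Sm sS hc h1 h2; apply: (wge_le ole).
have h0 : le 0 (rho - gamma) by apply: (le_shift ole hQR); zmod.
by apply: (le_shift ole (leMn ole i h0)); rewrite mul0rn; zmod.
Qed.

(** Some x in the cut and some q > 1 are such that stretching from x by q never leaves the cut.
    Iterating beats any factor n; beyond x, differences may thus be multiplied freely, as in a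
    convex subgroup. *)
Lemma gamma_multiples : ~ vert_bounded le (gammaQL le v nu Qs) ->
  exists X xi, mem_at X xi /\ forall Q gamma R rho n,
    mem_at Q gamma -> le xi gamma -> mem_at R rho -> le gamma rho ->
    exists S sigma, [/\ mem_at S sigma, le gamma sigma &
      le ((rho - gamma) *+ n) (sigma - gamma)].
Proof.
move=> nvb.
have [x [[xG [X [XQ hX]]] [q [q1 hq]]]] : exists x, gammaQL le v nu Qs x /\
    exists q : rat, 1 < q /\ forall y, gammaQL le v nu Qs y ->
      exists z, gammaQL le v nu Qs z /\ le (q *: (y - x)) (z - x).
  apply: NNPP => no; apply: nvb => x hx q q1; apply: NNPP => no'.
  apply: no; exists x; split=> //; exists q; split=> // y hy.
  apply: NNPP => no''; apply: no'; exists y; split=> // z hz.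
  by apply/negP => hz'; apply: no''; exists z.
have [xi hXi] := mem_at_of XQ; exists X, xi; split=> // Q gamma R rho n hQ hxg hR hQR.
have hx : le x gamma by apply: (le_tr ole _ hxg); move: hX; rewrite (proj2 hXi).
have pow k : exists S sigma, mem_at S sigma /\ le (q ^+ k *: (rho - x)) (sigma - x).
  elim: k => [|k [S [sigma [hS hle]]]].
    by exists R, rho; rewrite expr0 scale1r (le_refl ole).
  have [|z [[zG [T [TQ hT]]] hz]] := hq sigma.
    split; first exact: (mem_at_Gamma hS).
    by exists S; split; [apply: (proj1 hS) | rewrite (proj2 hS) /= (le_refl ole)].
  have [tau hTau] := mem_at_of TQ; exists T, tau; split=> //.
  rewrite (proj2 hTau) /= in hT.
  have h0 : le 0 (sigma - x - q ^+ k *: (rho - x)) by apply: (le_shift ole hle); zmod.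
  have h1 := le_scale ole (le_trans ler01 (ltW q1)) h0.
  rewrite scalerBr scalerA -exprS in h1.
  by apply: (le_shift ole (leD ole (leD ole h1 hz) hT)); zmod.
have [k hk] : exists k, (n%:R : rat) <= q ^+ k.
  have bern k : 1 + k%:R * (q - 1) <= q ^+ k.
    elim: k => [|k ih]; first by rewrite expr0 mul0r addr0.
    have h0 : 0 <= k%:R * (q - 1) ^+ 2 by rewrite mulr_ge0 // sqr_ge0.
    have h1 : q * (1 + k%:R * (q - 1)) <= q ^+ k.+1.
      by rewrite exprS ler_wpM2l //; lra.
    apply: le_trans h1; rewrite -subr_ge0.
    by move: h0; congr (0 <= _); rewrite -natr1; ring.
  (* With this k, Bernoulli gives q^(k+1) >= 1 + (k+1)(q - 1) > n. *)
  pose k := Num.truncn (n%:R / (q - 1)).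
  exists k.+1; apply: le_trans (bern k.+1).
  have := truncnS_gt (n%:R / (q - 1)); rewrite -/k => hk.
  have q0 : 0 < q - 1 by lra.
  by move: hk; rewrite ltr_pdivrMr //; lra.
have [S [sigma [hS hle]]] := pow k.
have r0 : le 0 (rho - x) by apply: (le_shift ole (le_tr ole hx hQR)); zmod.
have g0 : le 0 (gamma - x) by apply: (le_shift ole hx); zmod.
have h1 : le ((rho - x) *+ n) (sigma - x).
  apply: (le_tr ole _ hle); rewrite -scaler_nat.
  have h0 : 0 <= q ^+ k - n%:R by rewrite subr_ge0.
  have := le_scale ole h0 r0; rewrite scalerBl => h2.
  by apply: (le_shift ole h2); zmod.
case: n hk h1 => [_ _|n _ h1].
  by exists R, rho; split=> //; rewrite mulr0n; apply: (le_shift ole hQR); zmod.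
(* Moving the origin from x to gamma leaves a surplus n (gamma - x) >= 0. *)
have h2 : le ((rho - gamma) *+ n.+1) (sigma - gamma).
  have h3 := leMn ole n g0; rewrite mul0rn in h3.
  by apply: (le_shift ole (leD ole h1 h3)); zmod.
exists S, sigma; split=> //.
have h3 : le 0 (rho - gamma) by apply: (le_shift ole hQR); zmod.
have := leMn ole n.+1 h3; rewrite mul0rn => h4.
by apply: (le_shift ole (le_tr ole h4 h2)); zmod.
Qed.

(** * Coefficients of F along the family *)

Section Fixed.
Context (F : {poly K}).

(** A coefficient below the bound would dominate all later changes allowed by [qcoef_cauchy], and
    its value would stay constant. *)
Lemma eventually_ge Q gamma R rho b l :
  mem_at Q gamma -> mem_at R rho -> le gamma rho -> wge Q gamma b F ->
  ~ ult_const le nu Qs (fun S => beta nu F S l) ->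
  forall S sigma, mem_at S sigma -> le rho sigma ->
    nge (b - gamma *+ l + (rho - gamma)) (qcoef S F l).
Proof.
move=> hQ hR hl hF nconst S sigma hS hRS; apply/negPn/negP => hlt.
apply: nconst; exists (nu (qcoef S F l)); apply/eventuallyP; exists S, sigma.
split=> // T tau hT hST; rewrite /beta -[qcoef T F l](subrKC (qcoef S F l)).
case e : (nu (qcoef S F l)) hlt => [a|]; rewrite /nge e //= => hlt.
apply: (nu_dominant ole val e); apply: (nge_lt ole hlt).
apply: (nge_le ole _ (qcoef_cauchy l hQ hS hT (le_tr ole hl hRS) hST hF)).
by apply: (le_shift ole hRS); zmod.
Qed.

(** Failure of membership in J gives the bound only cofinally often; the values lie in Gamma, so not
    being above the cut means lying in it. *)
Lemma Bset_cofinal l Q gamma : Bset le v nu Qs F m l -> mem_at Q gamma ->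
  exists R rho b, [/\ mem_at R rho, le gamma rho, nu (qcoef R F l) = Some b &
    deltaL le v nu Qs F (b + rho *+ l)].
Proof.
move=> [lD nJ] hQ; apply: NNPP => no; apply: nJ; split=> //.
apply/eventuallyP; exists Q, gamma; split=> // R rho hR hl.
rewrite /above_delta /beta (nuX val l (proj2 hR)).
case e : (nu (qcoef R F l)) => [b|] //=.
have hG : inGamma v (b + rho *+ l).
  apply: (inGammaD valK val).
    apply: small_Gamma e; exact: (size_qcoef (mem_at_monic hR) (mem_at_size hR)).
  by apply: (inGammaMn valK val); apply: mem_at_Gamma hR.
by split=> // hd; apply: no; exists R, rho, b.
Qed.

Lemma deltaL_wge c : deltaL le v nu Qs F c ->
  exists R rho, mem_at R rho /\ wge R rho c F.
Proof.
move=> [_ [R [RQ]]]; have [rho hR] := mem_at_of RQ.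
move/(vle_nuQ ole val m_gt0 (mem_at_monic hR) (mem_at_size hR) _ _ (proj2 hR)).
by exists R, rho.
Qed.

(** * The derivative of F with respect to Q *)

Section TwoWeights.
Context (Q1 : {poly K}) (c1 : L) (Q : {poly K}) (gamma b : L) (l : nat).
Hypotheses (hQ1 : mem_at Q1 c1) (hQ : mem_at Q gamma) (hQ1Q : le c1 gamma).
Hypothesis hF : wge Q gamma b F.

(* the l-th Hasse derivative of sum_j F_{Q,j} Y^j with respect to Y, at Y = Q *)
Definition qderiv := (qpoly Q F)^`N(l).[Q].

Let Qm := mem_at_monic hQ.
Let sQ := mem_at_size hQ.

Lemma wge_qderiv : wge Q gamma (b - gamma *+ l) qderiv.
Proof.
apply: (wge_horner ole val m_gt0 Qm sQ (mem_at_carry hQ hQ (le_refl ole _))).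
- exact: (size_coef_qpoly m_gt0 Qm sQ).
- by move=> j; rewrite (coef_qpoly m_gt0 Qm sQ).
- exact: (wge_self ole val m_gt0).
Qed.

(** With x = Q - R, F is the sum of A^(k)(x) R^k. Its l-th R-coefficient gets the constant term of
    A^(l)(x), which is that of G, plus contributions from k < l; at weight c1 each of these gains (l
    - k)(gamma - c1). *)
Lemma qderiv_approx R rho : mem_at R rho -> le gamma rho ->
  nge (b - gamma *+ l + (gamma - c1)) (qcoef R qderiv 0 - qcoef R F l).
Proof.
move=> hR hQR; have [Rm sR] := (mem_at_monic hR, mem_at_size hR).
set A := qpoly Q F; pose x := Q - R.
have hx : wge R c1 gamma x.
  have [n1 n2] := mem_at_near hQ hR hQR.
  by apply: (wge_small val _ sR); [rewrite size_subC | rewrite -(ngeN ole val) opprB].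
have hp k : wge R c1 (b - gamma *+ k) A^`N(k).[x].
  apply: (wge_horner ole val m_gt0 Rm sR (mem_at_carry hQ1 hR (le_tr ole hQ1Q hQR))) => //.
    exact: (size_coef_qpoly m_gt0 Qm sQ).
  by move=> j; rewrite (coef_qpoly m_gt0 Qm sQ).
have eQ : Q = x + R by rewrite subrK.
have -> : qcoef R qderiv 0 = qcoef R A^`N(l).[x] 0.
  by rewrite !qcoef0E /qderiv -/A [X in _.[X]]eQ horner_mod.
pose n := (size A + l.+1)%N; have hl : (l < n)%N by rewrite /n addnS ltnS leq_addl.
have eF : qcoef R F l = \sum_(k < n) qcoef R (A^`N(k).[x] * R ^+ k) l.
  rewrite -qcoef_sum -nderiv_taylor_wide ?leq_addr //; last exact: mulrC.
  by rewrite -eQ (horner_qpoly m_gt0 Qm sQ).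
rewrite eF (bigD1 (Ordinal hl)) //= (qcoef_mulX Rm) leqnn subnn.
set t := \sum_(i < n | _) _; rewrite -(ngeN ole val) opprB [_ + t]addrC addrK.
apply: (nge_sum ole val) => k hk.
rewrite (qcoef_mulX Rm); case: leqP => hkl; last exact: (nge_zero val).
have {hk hkl}hkl : (k < l)%N by rewrite ltn_neqAle hkl andbT; move: hk; rewrite -val_eqE.
apply: (nge_le ole _ (hp k (l - k)%N)).
have [j ->] : exists j, l = (k + j.+1)%N.
  by exists (l - k.+1)%N; rewrite -addSnnS subnKC.
rewrite addKn.
have h0 : le 0 (gamma - c1) by apply: (le_shift ole hQ1Q); zmod.
by apply: (le_shift ole (leMn ole j h0)); rewrite mul0rn; zmod.
Qed.

(** Each term is a multiple of F_{Q,l+i} Q^i, which lacks l factors Q of a term of F. *)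
Lemma size_qderiv : (0 < l)%N -> F != 0 -> (size qderiv < size F)%N.
Proof.
move=> l0 F0; rewrite /qderiv horner_coef.
apply: (big_ind (fun p : {poly K} => (size p < size F)%N)).
- by rewrite size_poly0 size_poly_gt0.
- by move=> f g hf hg; apply: leq_ltn_trans (size_polyD _ _) _; rewrite gtn_max hf.
move=> i _; rewrite coef_nderivn (coef_qpoly m_gt0 Qm sQ) mulrnAl -scaler_nat.
apply: leq_ltn_trans (size_scale_leq _ _) _.
have [->|q0] := eqVneq (qcoef Q F (l + i)) 0.
  by rewrite mul0r size_poly0 size_poly_gt0.
have h1 := qcoef_size_lt m_gt0 Qm sQ q0.
have h2 := size_polyMleq (qcoef Q F (l + i)) (Q ^+ i).
have h3 := size_poly_exp_leq Q i; rewrite sQ /= in h3.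
have q0' : (0 < size (qcoef Q F (l + i)))%N by rewrite size_poly_gt0.
have arith (x y z k : nat) : (x + (l + k) * m <= z)%N -> (y <= (m * k).+1)%N ->
    (0 < x)%N -> ((x + y).-1 < z)%N.
  by move: m_gt0 l0; clear; nia.
by apply: leq_ltn_trans h2 _; apply: arith h1 h3 q0'.
Qed.

End TwoWeights.

(** * Limit key polynomials and the two kinds of index *)

Hypothesis hKP : KP_inf le nu Qs F.

Let F_neq0 : F != 0. Proof. by case: hKP => /monic_neq0. Qed.

(** Minimality of deg F concerns monic polynomials; dividing by the leading coefficient shifts all
    values alike. *)
Lemma stable_of_size_lt h : (size h < size F)%N ->
  exists T tau, mem_at T tau /\ forall R rho b, mem_at R rho -> le tau rho ->
    nge b h -> wge R rho b h.
Proof.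
move=> sh; have [->|h0] := eqVneq h 0.
  by have [T [tau hT]] := mem_at_ex; exists T, tau; split=> // *; apply: (wge_zero val).
set x := lead_coef h; have x0 : x != 0 by rewrite lead_coef_eq0.
have st : stable le nu Qs (x^-1 *: h).
  apply: NNPP => ns; case: hKP => _ _ /(_ (x^-1 *: h)).
  rewrite monicE lead_coefZ mulVf // eqxx => /(_ isT ns).
  by rewrite size_scale ?invr_eq0 // leqNgt sh.
move/eventuallyP: st => [T [tau [hT hst]]]; exists T, tau; split=> // R rho b hR hl hb i.
have xV0 : x^-1 != 0 by rewrite invr_eq0.
have [a ha] := nu_const_fin valK val xV0.
have := ngeM ole val (nge_nu ole ha) hb; rewrite mul_polyC /nge -(hst _ _ hR hl).
move/(vle_nuQ ole val m_gt0 (mem_at_monic hR) (mem_at_size hR) _ _ (proj2 hR)) => /(_ i).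
rewrite qcoefZ -mul_polyC /nge (nuM val) ha.
by case: (nu _) => //= c hc; apply: (le_shift ole hc); zmod.
Qed.

(* If gamma_Q1 lies a whole convex subgroup below the cut, the derivative of F
   with respect to Q would be an unstable polynomial of degree less than deg F. *)
Lemma Bset_const_of_gap xi Q1 c1 Q gamma l :
  (forall Q gamma R rho n,
    mem_at Q gamma -> le xi gamma -> mem_at R rho -> le gamma rho ->
    exists S sigma, [/\ mem_at S sigma, le gamma sigma &
      le ((rho - gamma) *+ n) (sigma - gamma)]) ->
  mem_at Q1 c1 -> mem_at Q gamma -> le xi gamma -> le c1 gamma ->
  (forall R rho, mem_at R rho -> lt (rho - gamma) (gamma - c1)) -> (0 < l)%N ->
  Bset le v nu Qs F m l -> ult_const le nu Qs (fun S => beta nu F S l).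
Proof.
move=> mult hQ1 hQ hxi hg1 gap l0 hB; apply: NNPP => nconst.
have [Qm sQ] := (mem_at_monic hQ, mem_at_size hQ).
have [b0 nuF] := nuQ_fin ole val m_gt0 Qm sQ (proj2 hQ) small_fin F_neq0.
have hF : wge Q gamma b0 F.
  by apply/(vle_nuQ ole val m_gt0 Qm sQ _ _ (proj2 hQ)); rewrite nuF /= (le_refl ole).
have b0max c : wge Q gamma c F -> le c b0.
  by move/(vle_nuQ ole val m_gt0 Qm sQ _ _ (proj2 hQ)); rewrite nuF.
set G := qderiv Q l; pose U := b0 - gamma *+ l.
have hG : wge Q gamma U G := wge_qderiv l hQ hF.
have approx := qderiv_approx l hQ1 hQ hg1 hF.
have [T [tau [hT hst]]] := stable_of_size_lt (size_qderiv hQ l0 F_neq0).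
have [V [kap [hV hTV hQV]]] := mem_at_max hT hQ.
have [R [rho [be [hR hVR nuR hdelta]]]] := Bset_cofinal hB hV.
have hQR := le_tr ole hQV hVR.
have [R2 [rho2 [hR2 hF2]]] := deltaL_wge hdelta.
have [R3 [rho3 [hR3 hR23 hQR3]]] := mem_at_max hR2 hQ.
have {}hF2 := wge_mono hR2 hR3 hR23 hF2.
(* Back at weight gamma and base Q, the bound on F is at most b0 = nu_Q(F); the loss is absorbed by
   a later difference rho4 - gamma. *)
have := wge_weight_down ole val m_gt0 (mem_at_monic hR3) (mem_at_size hR3) hQR3 hF2.
move/(wge_down hQ hR3 hQR3)/b0max => hb0.
have [R4 [rho4 [hR4 hQR4 hmul]]] := mult _ _ _ _ (size F) hQ hxi hR3 hQR3.
have hbe : le be (U + (rho4 - gamma)).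
  by apply: (le_shift ole (leD ole (leD ole hb0 hmul) (leMn ole l hQR))); rewrite /U; zmod.
(* By the gap, the constant R-coefficient of G has value exactly [be]; stability of G makes this an
   upper bound for nu(G). *)
have Gle c : nge c G -> le c (U + (rho4 - gamma)).
  move=> hc; apply: (le_tr ole _ hbe).
  have := hst _ _ _ hR (le_tr ole hTV hVR) hc 0%N.
  rewrite mulr0n subr0 -(subrKC (qcoef R F l) (qcoef R G 0)).
  suff /nge_Some -> : nu (qcoef R F l + (qcoef R G 0 - qcoef R F l)) = Some be by [].
  apply: (nu_dominant ole val nuR); apply: (nge_lt ole _ (approx _ _ hR hQR)).
  by apply: (le_lt_tr ole hbe); apply: (lt_shift ole (gap _ _ hR4)); rewrite /U; zmod.
(* Nonconstancy yields the lower bound U + (rho5 - gamma) for nu(G), which exceeds the upper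
   bound. *)
have [R5 [rho5 [hR5 hlt5]]] := mem_at_nomax hR4.
have hQR5 := le_tr ole hQR4 (lt_le ole hlt5).
have hge := eventually_ge hQ hR5 hQR5 hF nconst hR5 (le_refl ole _).
have hG5 : wge R5 rho5 (U + (rho5 - gamma)) G.
  move=> [|i].
    rewrite mulr0n subr0 -(subrKC (qcoef R5 F l) (qcoef R5 G 0)).
    apply: (ngeD ole val) => //; apply: (nge_le ole _ (approx _ _ hR5 hQR5)).
    by apply: (le_shift ole (lt_le ole (gap _ _ hR5))); rewrite /U; zmod.
  apply: (nge_le ole _ (wge_up hQ hR5 hQR5 hG i.+1)).
  have h0 : le 0 (rho5 - gamma) by apply: (le_shift ole hQR5); zmod.
  by apply: (le_shift ole (leMn ole i h0)); rewrite mul0rn /U; zmod.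
have hn5 := nge_nu ole (proj2 hR5).
have := Gle _ (wge_nge ole val m_gt0 (mem_at_monic hR5) (mem_at_size hR5) hn5 hG5).
move=> h; case/negP: hlt5; apply: (le_shift ole h); zmod.
Qed.

Lemma Bset_dichotomy l : ~ vert_bounded le (gammaQL le v nu Qs) ->
  Bset le v nu Qs F m l -> Bct le v nu Qs F m l \/ Bunb le v nu Qs F m l.
Proof.
move=> /gamma_multiples [X [xi [hX mult]]] hB.
case: (classic (ult_const le nu Qs (fun S => beta nu F S l))) => [|nconst]; first by left.
right; split=> // b [_ [b' [_ hbb' [Q1 [c1 [Q1Q nuQ1 hdelta]]]]]].
have hQ1 : mem_at Q1 c1 by [].
have [Q2 [c2 [hQ2 hF2]]] := deltaL_wge hdelta.
have [V [kap [hV hXV hQ1V]]] := mem_at_max hX hQ1.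
have [Q [gamma [hQ hVQ hQ2Q]]] := mem_at_max hV hQ2.
have hF := wge_mono hQ2 hQ hQ2Q hF2.
have hQ1Q := le_tr ole hQ1V hVQ; have hXQ := le_tr ole hXV hVQ.
(* Either the gain rho - gamma eventually makes up for l (gamma - c1), or no difference reaches even
   gamma - c1, by closure under multiples. *)
have [[R [rho [hR hQR hle]]]|no] := classic (exists R rho,
  [/\ mem_at R rho, le gamma rho & le ((gamma - c1) *+ l) (rho - gamma)]).
  apply/eventuallyP; exists R, rho; split=> // S sigma hS hRS.
  apply: (nge_le ole _ (eventually_ge hQ hR hQR hF nconst hS hRS)).
  by apply: (le_shift ole (leD ole hbb' hle)); zmod.
case: nconst; case: (posnP l) => [l0|l0].
  case: no; exists Q, gamma; rewrite l0 mulr0n subrr (le_refl ole).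
  by split=> //; apply: (le_refl ole).
apply: (Bset_const_of_gap mult hQ1 hQ hXQ hQ1Q) => // R rho hR.
apply/negP => hle; apply: no.
have h0 : le 0 (gamma - c1) by apply: (le_shift ole hQ1Q); zmod.
have hQR : le gamma rho by apply: (le_shift ole (le_tr ole h0 hle)); zmod.
have [S [sigma [hS hQS h]]] := mult _ _ _ _ l hQ hXQ hR hQR.
by exists S, sigma; split=> //; apply: (le_tr ole (leMn ole l hle)).
Qed.

(** For l > 0 the growth of gamma_Q gives a bound in [calB] above the constant; for l = 0 a constant
    value would make F stable. *)
Lemma Bct_Bunb_disjoint l : Bct le v nu Qs F m l -> Bunb le v nu Qs F m l -> False.
Proof.
move=> [hB [c /eventuallyP [T [tau [hT hc]]]]] [_ hunb].
have [T' [tau' [hT' hlt]]] := mem_at_nomax hT.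
have [R [rho [b [hR hTR nuR hdelta]]]] := Bset_cofinal hB hT'.
have {}hTR := lt_le_tr ole hlt hTR.
have {}hc S sigma : mem_at S sigma -> le tau sigma -> nu (qcoef S F l) = Some b.
  by move=> hS hl; rewrite -nuR; have := hc _ _ hR (lt_le ole hTR); rewrite /beta => ->;
     apply: hc hS hl.
case: (posnP l) => [l0|l0]; last first.
  (* Chosen so that b' + l tau = b + l rho lies in the cut, while b' > b since rho > tau and l >
     0. *)
  pose b' := b + (rho - tau) *+ l.
  have eb : b' + tau *+ l = b + rho *+ l by rewrite /b'; zmod.
  have b'G : inGamma v b'.
    have -> : b' = (b + rho *+ l) + - (tau *+ l) by rewrite /b'; zmod.
    apply: (inGammaD valK val); first by case: hdelta.
    by apply: (inGammaN val); apply: (inGammaMn valK val); apply: mem_at_Gamma hT.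
  have [|V [kap [hV hge]]] := (proj1 (eventuallyP _)) (hunb b' _).
    split=> //; exists b'; split=> //; first exact: (le_refl ole).
    by exists T, tau; split; [case: hT | case: hT | rewrite eb].
  have [S [sigma [hS hVS hTS]]] := mem_at_max hV hT.
  have := hge _ _ hS hVS; rewrite /beta (hc _ _ hS hTS) /= => hle.
  have := ltMn ole l0 hTR; case/negP; apply: (le_shift ole hle); rewrite /b'; zmod.
case: hKP => _ + _; apply; apply/eventuallyP.
rewrite l0 mulr0n addr0 in hc hdelta.
have [R2 [rho2 [hR2 hF2]]] := deltaL_wge hdelta.
have [R3 [rho3 [hR3 hlt3]]] := mem_at_nomax hR2.
have [V [kap [hV hR3V hTV]]] := mem_at_max hR3 hT.
exists V, kap; split=> // S sigma hS hVS.
have hlt2 := lt_le_tr ole (lt_le_tr ole hlt3 hR3V) hVS.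
have [Sm sS] := (mem_at_monic hS, mem_at_size hS).
have hS2 := wge_up hR2 hS (lt_le ole hlt2) hF2.
have hS0 := hc _ _ hS (le_tr ole hTV hVS).
(* Past rho2 all terms of positive index have value above b; the expansion is taken one term too
   long so that index 0 splits off. *)
have nuF : nu F = Some b.
  rewrite (qcoef_expand m_gt0 Sm sS (leqnSn (size F))) big_ord_recl expr0 mulr1.
  apply: (nu_dominant ole val hS0); apply: (ngt_sum ole val) => i _.
  rewrite /= /bump leq0n add1n.
  apply: (nge_lt ole _ (ngeM ole val (hS2 i.+1) (nge_nu ole (nuX val i.+1 (proj2 hS))))).
  by apply: (lt_shift ole (ltMn ole (ltn0Sn i) hlt2)); zmod.
have hw d : vle le (Some d) (nuQ le nu S F) = le d b.
  apply/idP/idP => [/(vle_nuQ ole val m_gt0 Sm sS _ _ (proj2 hS)) hd|hd].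
    by have := hd 0%N; rewrite mulr0n subr0 (nge_Some _ _ hS0).
  apply/(vle_nuQ ole val m_gt0 Sm sS _ _ (proj2 hS)).
  by apply: (wge_le ole hd); apply: (wge_weight ole (lt_le ole hlt2)).
have [d e] := nuQ_fin ole val m_gt0 Sm sS (proj2 hS) small_fin F_neq0.
rewrite nuF e; congr Some; apply: (le_asym ole); first by rewrite -hw e /= (le_refl ole).
by have := hw b; rewrite e (le_refl ole).
Qed.

End Fixed.
End Family.

Theorem mainTheorem14 (K : fieldType) (L : lmodType rat) (le : rel L)
  (v : K -> option L) (nu : {poly K} -> option L)
  (m : nat) (Qs : {poly K} -> Prop) (F : {poly K}) :
  ordered_group le ->
  is_valuation_K le v ->
  is_valuation_ext le v nu ->
  well_specified le v nu ->
  (1 <= m)%N ->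
  (exists Q, Psi le nu m Q) ->
  (forall Q, Psi le nu m Q -> exists R, Psi le nu m R /\ vlt le (nu Q) (nu R)) ->
  (* Qs is a subset of Psi_m, well-ordered by nu-values, and cofinal *)
  (forall Q, Qs Q -> Psi le nu m Q) ->
  (forall Q R, Qs Q -> Qs R -> nu Q = nu R -> Q = R) ->
  (forall S : {poly K} -> Prop, (forall Q, S Q -> Qs Q) -> (exists Q, S Q) ->
     exists Q, S Q /\ forall R, S R -> vle le (nu Q) (nu R)) ->
  (forall P, Psi le nu m P -> exists Q, Qs Q /\ vle le (nu P) (nu Q)) ->
  (* unstable polynomials exist, and F is a limit key polynomial *)
  (exists f, ~ stable le nu Qs f) ->
  KP_inf le nu Qs F ->
  (* Qs is vertically unbounded *)
  ~ vert_bounded le (gammaQL le v nu Qs) ->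
  (* s_infty = 1 *)
  eventually le nu Qs (fun Q => forall s, Iset le nu Q s <-> s = 1%N) ->
  forall l : nat,
    (Bset le v nu Qs F m l <->
       Bct le v nu Qs F m l \/ Bunb le v nu Qs F m l) /\
    ~ (Bct le v nu Qs F m l /\ Bunb le v nu Qs F m l).
Proof.
move=> ole valK val _ m_gt0 Pex Pnomax QP _ _ Qcof _ hKP nvb _ l; split.
  split; last by case=> -[].
  exact: (Bset_dichotomy ole valK val m_gt0 Pex Pnomax QP Qcof hKP nvb).
case=> hct hunb.
exact: (Bct_Bunb_disjoint ole valK val m_gt0 Pex Pnomax QP Qcof hKP hct hunb).
Qed.
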